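(* Let $q$ be a prime power, in the setting of the context. Let $\mathcal{C}$ be the set of planes of $V$ obtained from $\mathcal{L}=\{\Gamma_f:f\in\mathcal{G}\}$ by removing all planes $\Gamma_f$ with $f\in\mathcal{R}$ and adding all planes of the form $N(Z,\mathbb{F}_q(ab^q-a^qb),f|_Z)$, where $Z=\langle a,b\rangle$ ranges over the $2$-dimensional $\mathbb{F}_q$-subspaces of $W$ and $f$ ranges over $\mathcal{R}$. Then $\mathcal{C}$ is a plane subspace code of size $\#\mathcal{C}=q^8+q^3+q^2$. Moreover, $\mathcal{C}$ can be augmented by $q^4+q^3+2q^2+q+1$ further planes, each meeting $S$ in a $2$-dimensional subspace, to a plane subspace code $\widehat{\mathcal{C}}$ of size $q^8+q^4+2q^3+3q^2+q+1$.
   Context: $\mathbb{F}_{q^4}$ is viewed as a $4$-dimensional $\mathbb{F}_q$-space. $W=\{x\in\mathbb{F}_{q^4}:x+x^q+x^{q^2}+x^{q^3}=0\}$, $V=W\times\mathbb{F}_{q^4}$ (a $7$-dimensional $\mathbb{F}_q$-space), $S=\{0\}\times\mathbb{F}_{q^4}$. Planes are $3$-dimensional $\mathbb{F}_q$-subspaces; a plane subspace code is a set of planes of $V$ pairwise intersecting in dimension at most $1$. For $\mathbb{F}_q$-linear $f\colon W\to\mathbb{F}_{q^4}$, $\Gamma_f=\{(x,f(x)):x\in W\}$. $\mathcal{G}=\{x\mapsto a_0x+a_1x^q:a_0,a_1\in\mathbb{F}_{q^4}\}$ and $\mathcal{R}=\{x\mapsto ax^q-a^qx: a\in\mathbb{F}_{q^4}\}$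 (maps $W\to\mathbb{F}_{q^4}$). For an $\mathbb{F}_q$-subspace $Z\subseteq W$, an $\mathbb{F}_q$-subspace $T\subseteq\mathbb{F}_{q^4}$ and $\mathbb{F}_q$-linear $g\colon Z\to\mathbb{F}_{q^4}$, $N(Z,T,g)=\{(x,g(x)+y):x\in Z,y\in T\}$. *)

(* Defs.v *)
From HB Require Import structures.
From mathcomp Require Import all_boot all_order all_algebra all_field.
From mathcomp Require Import classical_sets cardinality.

Set Implicit Arguments.
Unset Strict Implicit.
Unset Printing Implicit Defensive.

Import GRing.Theory.
Local Open Scope classical_set_scope.
Local Open Scope ring_scope.

Definition plane_code (K : fieldType) (vT : vectType K)
    (C : set {vspace vT}) : Prop :=
  (forall U, C U -> \dim U = 3%N :> nat) /\
  (forall U U', C U -> C U' -> U <> U' -> (\dim (U :&: U') <= 1)%N).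

(* The constructions Gamma_f and N(Z, T, g), for spaces uT and vT in place of
   W and L; both live in the product space uT * vT. *)
Section Graphs.

Variables (K : fieldType) (uT vT : vectType K).

Definition graph_map (f : 'Hom(uT, vT)) (x : uT) : uT * vT := (x, f x).

Lemma graph_map_is_linear f : linear (graph_map f).
Proof. by move=> c x y; rewrite /graph_map linearP. Qed.

HB.instance Definition _ f :=
  GRing.isLinear.Build K uT (uT * vT)%type *:%R (graph_map f)
    (graph_map_is_linear f).

Definition Gamma (f : 'Hom(uT, vT)) : {vspace (uT * vT)} :=
  limg (linfun (graph_map f)).

Lemma mem_Gamma f u : (u \in Gamma f) = (u.2 == f u.1).
Proof.
apply/memv_imgP/eqP => [[x _ ->]|]; first by rewrite lfunE.
by case: u => x y /= ->; exists x; rewrite ?memvf // lfunE.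
Qed.

Variables (Z : {vspace uT}) (T : {vspace vT}).

Definition N_map (g : 'Hom(subvs_of Z, vT)) (p : subvs_of Z * subvs_of T) :
  uT * vT := (vsval p.1, g p.1 + vsval p.2).

Lemma N_map_is_linear g : linear (N_map g).
Proof.
move=> c [x y] [x' y']; rewrite /N_map /= (linearP g).
by congr (_, _); rewrite /= scalerDr addrACA.
Qed.

HB.instance Definition _ g :=
  GRing.isLinear.Build K (subvs_of Z * subvs_of T)%type (uT * vT)%type *:%R
    (N_map g) (N_map_is_linear g).

Definition spaceN (g : 'Hom(subvs_of Z, vT)) : {vspace (uT * vT)} :=
  limg (linfun (N_map g)).

Lemma mem_spaceN (g : 'Hom(subvs_of Z, vT)) u :
  reflect (exists x : subvs_of Z,
             exists2 y, y \in T & u = (vsval x, g x + y))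
          (u \in spaceN g).
Proof.
apply: (iffP idP) => [/memv_imgP[[x y] _ ->]|[x [y Ty ->]]].
  by exists x, (vsval y); rewrite ?subvsP // lfunE.
by apply/memv_imgP; exists (x, Subvs Ty); rewrite ?memvf // lfunE.
Qed.

Definition restr (f : 'Hom(uT, vT)) : 'Hom(subvs_of Z, vT) :=
  (f \o linfun vsval)%VF.

Lemma restrE f x : restr f x = f (vsval x).
Proof. by rewrite comp_lfunE lfunE. Qed.

End Graphs.

Section Setting.

(* F is the field with q elements; L is the field with q^4 elements as soon as
   \dim {:L} = 4, which is assumed in the theorem only. *)
Variables (F : finFieldType) (L : fieldExtType F).

Local Notation q := #|F|.

Definition trace4 (x : L) : L := x + x ^+ q + x ^+ (q ^ 2) + x ^+ (q ^ 3).

Lemma exprq_is_linear n : linear (fun x : L => x ^+ (q ^ n)).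
Proof.
move=> c x y; have [p p_pr pcharF] := finPcharP F.
have pcharL : p \in [pchar L] by rewrite (pchar_lalg L).
have qnat : [pchar L].-nat (q ^ n)%N.
  rewrite (card_pprimeChar pcharF) -expnM pnatX.
  by rewrite pnatE // pcharL.
rewrite exprDn_pchar // exprZn; congr (_ *: _ + _).
by elim: n {qnat} => [|n IHn]; rewrite ?expr1 // expnSr exprM IHn expf_card.
Qed.

Lemma trace4_is_linear : linear trace4.
Proof.
move=> c x y; rewrite /trace4.
have := exprq_is_linear 1 c x y; rewrite /= expn1 => ->.
have /= -> := exprq_is_linear 2 c x y; have /= -> := exprq_is_linear 3 c x y.
by rewrite !scalerDr; do 3![rewrite [RHS]addrACA; congr (_ + _)].
Qed.

HB.instance Definition _ :=
  GRing.isLinear.Build F L L *:%R trace4 trace4_is_linear.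

Definition spaceW : {vspace L} := lker (linfun trace4).

Lemma mem_spaceW x :
  (x \in spaceW) = (x + x ^+ q + x ^+ (q ^ 2) + x ^+ (q ^ 3) == 0).
Proof. by rewrite memv_ker lfunE. Qed.

Definition spaceV : vectType F := (subvs_of spaceW * L)%type.

Definition inj2 (y : L) : spaceV := (0, y).

Lemma inj2_is_linear : linear inj2.
Proof.
move=> c x y; rewrite /inj2.
by have {1}<- : c *: 0 + 0 = 0 :> subvs_of spaceW by rewrite scaler0 addr0.
Qed.

HB.instance Definition _ :=
  GRing.isLinear.Build F L spaceV *:%R inj2 inj2_is_linear.

Definition spaceS : {vspace spaceV} := limg (linfun inj2).

Lemma mem_spaceS (v : spaceV) : (v \in spaceS) = (v.1 == 0).
Proof.
apply/memv_imgP/eqP => [[y _ ->]|]; first by rewrite lfunE.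
by case: v => x y /= ->; exists y; rewrite ?memvf // lfunE.
Qed.

Definition calG : set 'Hom(subvs_of spaceW, L) :=
  [set f | exists a0 a1 : L,
     forall x, f x = a0 * vsval x + a1 * vsval x ^+ q].

Definition calR : set 'Hom(subvs_of spaceW, L) :=
  [set f | exists a : L,
     forall x, f x = a * vsval x ^+ q - a ^+ q * vsval x].

Definition calL : set {vspace spaceV} := [set Gamma f | f in calG].

(* A subspace Z of W is an element of {vspace (subvs_of spaceW)}; the line
   F_q (a b^q - a^q b) depends on Z only, not on the basis (a, b). *)
Definition added_planes : set {vspace spaceV} :=
  [set U | exists Z : {vspace (subvs_of spaceW)}, exists a b : subvs_of spaceW,
     exists f : 'Hom(subvs_of spaceW, L),
     [/\ \dim Z = 2%N :> nat, Z = (<[a]> + <[b]>)%VS, calR f &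
         U = spaceN <[vsval a * vsval b ^+ q - vsval a ^+ q * vsval b]>
               (restr Z f)]].

Definition calC : set {vspace spaceV} :=
  (calL `\` [set Gamma f | f in calR]) `|` added_planes.

End Setting.

Arguments spaceW {F} L.
Arguments spaceV {F} L.
Arguments spaceS {F} L.
Arguments calG {F} L.
Arguments calR {F} L.
Arguments calL {F} L.
Arguments added_planes {F} L.
Arguments calC {F} L.

(* Main.v *)
From HB Require Import structures.
Require Import Defs.
From mathcomp Require Import all_boot all_order all_algebra all_field.
From mathcomp Require Import finmap boolp classical_sets cardinality.
From mathcomp Require Import ring zify.

Set Implicit Arguments.
Unset Strict Implicit.
Unset Printing Implicit Defensive.

(** Write [moore a b = a b^q - a^q b], so that [R] consists of the maps
    [x |-> moore c x].

    A map [a0 x + a1 x^q] that vanishes on two independent vectors is zero, which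
    controls the intersections with the graphs.  The fibre
    [T_Z = <moore a b>] of [N(Z, T_Z, f)] over [0] determines [Z] among the
    2-dimensional subspaces of [W], because two of them meet; and [moore c]
    maps a nonzero vector of [Z] into [T_Z] exactly when [c] lies in [Z].  This
    bounds all intersections of added planes and shows that [q^2] of the maps of
    [R] give the same plane over [Z].

    For the augmentation, let [M_x = {moore x w | w in W}].  The 2-dimensional
    subspaces [M_x] of [L] meet pairwise and are distinct for the [q^2 + q + 1]
    points [<x>] of [W].  Every line parallelism of [PG(3, q)] has [q^2 + q + 1]
    spreads, so each of its spreads contains exactly one [M_x].  A 2-dimensional
    [E] in the spread of [M_x] is lifted to the plane [0 * E + <(x, y_x)>], where
    [y_x] lies outside the proper subspace [{moore c x | c in L}], which contains
    [M_x]: if [E] differs from [M_x], then [E] meets no [T_Z] with [x] in [Z], and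
    if [E = M_x], then no point over [x] is shared with an added plane.

    The parallelism lives on [K * K] with [K] the field of order [q^2].  Its
    spreads are indexed by the lines of the projective closure of the affine plane
    [K = AG(2, q)].  The [K]-subspaces go to the line at infinity.  A subspace
    [y = c x + d x^q] with [d <> 0] has the circle [c + d x^(q-1)] as set of
    slopes [y / x] and goes to the image under [z |-> c + d z] of a fixed affine
    line missing all [x^(q-1)]; each remaining subspace has an affine line as set
    of slopes and goes to that line.  The fixed line exists only for [q > 2]; for
    [q = 2] the lines of slopes are shifted instead, by means of [sigma]. *)

Import GRing.Theory.
Local Open Scope ring_scope.

(** * Linear algebra and counting over a finite field *)

Section LinearAlgebra.

Variables (K : fieldType) (vT : vectType K).
Implicit Types (a b u v : vT) (U : {vspace vT}).

Definition indep a b := (a != 0) && (b \notin <[a]>%VS).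

Lemma mem_line2P a b u :
  reflect (exists k l, u = k *: a + l *: b) (u \in (<[a]> + <[b]>)%VS).
Proof.
apply: (iffP memv_addP) => [[x /vlineP[k ->] [y /vlineP[l ->] ->]]|[k [l ->]]].
  by exists k, l.
by exists (k *: a); rewrite ?memvZ ?memv_line //; exists (l *: b);
  rewrite ?memvZ ?memv_line.
Qed.

Lemma mem_line2l a b : a \in (<[a]> + <[b]>)%VS.
Proof. by apply/mem_line2P; exists 1, 0; rewrite scale1r scale0r addr0. Qed.

Lemma mem_line2r a b : b \in (<[a]> + <[b]>)%VS.
Proof. by rewrite addvC mem_line2l. Qed.

Lemma dim_line2 a b : indep a b -> \dim (<[a]> + <[b]>) = 2%N.
Proof.
case/andP=> a0 ba; have b0 : b != 0 by apply: contraNneq ba => ->; rewrite mem0v.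
rewrite dimv_disjoint_sum ?dim_vline ?a0 ?b0 //; apply/eqP; rewrite -subv0.
apply/subvP => u /memv_capP[/vlineP[k ->] /vlineP[l kl]]; rewrite memv0.
rewrite scaler_eq0 (negPf a0) orbF; apply: contraNT ba => k0.
have l0 : l != 0.
  apply: contraNneq k0 => l0; move/eqP: kl.
  by rewrite l0 scale0r scaler_eq0 (negPf a0) orbF.
apply/vlineP; exists (l^-1 * k).
by rewrite -scalerA kl scalerA mulVf ?scale1r.
Qed.

Lemma dim2_indep a b : \dim (<[a]> + <[b]>) = 2%N -> indep a b.
Proof.
move=> d2; apply/andP; split; apply/negP.
  by move/eqP=> a0; move: d2; rewrite a0 add0v dim_vline; case: eqP.
by rewrite memvE => /addv_idPl ab; move: d2; rewrite ab dim_vline; case: eqP.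
Qed.

Lemma line2_eq a b U : \dim U = 2%N -> indep a b -> a \in U -> b \in U ->
  (<[a]> + <[b]>)%VS = U.
Proof.
move=> dU ab aU bU; apply/eqP; rewrite eqEdim dU (dim_line2 ab) leqnn andbT.
by rewrite subv_add -!memvE aU.
Qed.

Lemma exists_notin U V : (\dim V < \dim U)%N -> exists2 u, u \in U & u \notin V.
Proof.
move=> dVU; apply/subvPn; apply: contraL dVU => /dimvS.
by rewrite leqNgt.
Qed.

Lemma dim2P U : \dim U = 2%N -> exists a b, indep a b /\ U = (<[a]> + <[b]>)%VS.
Proof.
move=> dU; have U0 : U != 0%VS by rewrite -dimv_eq0 dU.
have a0 : vpick U != 0 by rewrite vpick0.
have [|b bU bN] := @exists_notin U <[vpick U]>; first by rewrite dim_vline a0 dU.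
have ab : indep (vpick U) b by rewrite /indep a0.
by exists (vpick U), b; rewrite (line2_eq dU ab) ?memv_pick.
Qed.

Lemma dim1P U : \dim U = 1%N -> exists2 a, a != 0 & U = <[a]>%VS.
Proof.
move=> dU; have U0 : U != 0%VS by rewrite -dimv_eq0 dU.
have a0 : vpick U != 0 by rewrite vpick0.
exists (vpick U) => //; apply/esym/eqP.
by rewrite eqEdim -memvE memv_pick dim_vline a0 dU.
Qed.

Lemma dim_le1 U : (forall u v, u \in U -> v \in U -> ~~ indep u v) ->
  (\dim U <= 1)%N.
Proof.
move=> H; case: (eqVneq U 0%VS) => [->|U0]; first by rewrite dimv0.
have a0 : vpick U != 0 by rewrite vpick0.
suff /dimvS : (U <= <[vpick U]>)%VS by rewrite dim_vline a0.
apply/subvP => v vU; apply: contraNT (H _ _ (memv_pick U) vU) => vN.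
by rewrite /indep a0.
Qed.

Lemma eq_dim_cap U V n : \dim U = n -> \dim V = n -> (n <= \dim (U :&: V))%N ->
  U = V.
Proof.
move=> dU dV dn.
have /eqP <- : (U :&: V)%VS == U by rewrite eqEdim capvSl dU.
by apply/eqP; rewrite eqEdim capvSr dV.
Qed.

Lemma indep_neq0r a b : indep a b -> b != 0.
Proof. by case/andP=> _; apply: contraNneq => ->; rewrite mem0v. Qed.

End LinearAlgebra.

(** * Projection and zero fibre of a subspace of a product *)

Section ProductSpace.

Variables (K : fieldType) (uT vT : vectType K).
Implicit Types (U : {vspace (uT * vT)}).

Definition inr_fun (y : vT) : uT * vT := (0, y).

Lemma inr_fun_is_linear : linear inr_fun.
Proof. by move=> c x y; congr (_, _); rewrite /= scaler0 addr0. Qed.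
HB.instance Definition _ :=
  GRing.isLinear.Build K vT (uT * vT)%type *:%R inr_fun inr_fun_is_linear.

Definition proj1v U : {vspace uT} := (linfun fst @: U)%VS.
Definition fiber0 U : {vspace vT} := (linfun inr_fun @^-1: U)%VS.

Lemma mem_proj1v U x : reflect (exists y, (x, y) \in U) (x \in proj1v U).
Proof.
apply: (iffP memv_imgP) => [[[x' y] xyU ->]|[y xyU]].
  by exists y; rewrite lfunE.
by exists (x, y); rewrite ?lfunE.
Qed.

Lemma mem_fiber0 U y : (y \in fiber0 U) = ((0, y) \in U).
Proof. by rewrite -memv_preim lfunE. Qed.

(** Rank-nullity for the first projection, whose kernel on [U] is a copy of [fiber0 U]. The
    intersection bounds for planes of [V] come from bounding the two summands separately. *)
Lemma dim_prod_space U : \dim U = (\dim (proj1v U) + \dim (fiber0 U))%N.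
Proof.
rewrite -(limg_ker_dim (linfun fst) U) addnC; congr (_ + _)%N.
have -> : (U :&: lker (linfun fst) = linfun inr_fun @: fiber0 U)%VS.
  apply/vspaceP => -[x y]; rewrite memv_cap memv_ker lfunE /=.
  apply/andP/memv_imgP => [[xyU /eqP x0]|[y' yU]].
    by exists y; rewrite ?mem_fiber0 ?lfunE /= /inr_fun -?x0.
  by rewrite lfunE /= => -[-> ->]; rewrite -mem_fiber0 yU eqxx.
rewrite limg_dim_eq //; apply/eqP; rewrite -subv0; apply/subvP => y.
rewrite memv_cap memv_ker lfunE /= memv0 => /andP[_].
by rewrite /inr_fun => /eqP[->].
Qed.

Lemma proj1v_cap U U' : (proj1v (U :&: U') <= proj1v U :&: proj1v U')%VS.
Proof. exact: limg_cap. Qed.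

Lemma fiber0_cap U U' : fiber0 (U :&: U') = (fiber0 U :&: fiber0 U')%VS.
Proof. by apply/vspaceP => y; rewrite memv_cap !mem_fiber0 memv_cap. Qed.

End ProductSpace.

(** * Counting by fibres, vectors and ordered bases *)

Section Counting.

Lemma count_allpairs (T T' : Type) (p : pred (T * T')) (s : seq T) (t : seq T') :
  count p [seq (x, y) | x <- s, y <- t]
    = (\sum_(x <- s) count (fun y => p (x, y)) t)%N.
Proof.
elim: s => [|x s IHs]; first by rewrite big_nil.
by rewrite allpairs_cons count_cat IHs big_cons count_map.
Qed.

(** Double counting of the pairs (x, z) with z = g x. It serves to count objects given by redundant
    parameters: subspaces by ordered bases, added planes by a basis and a map, spreads by nonzero
    vectors. *)
Lemma size_fibers (T T' : eqType) (g : T -> T') (s : seq T) k :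
    (forall x, x \in s -> count (fun y => g y == g x) s = k) ->
  size s = (size (undup (map g s)) * k)%N.
Proof.
move=> gk; rewrite -sum1_size.
transitivity (\sum_(x <- s) \sum_(z <- undup (map g s)) (g x == z))%N.
  apply: eq_big_seq => x xs; have := map_f g xs; rewrite -mem_undup => gx.
  rewrite (perm_big _ (perm_to_rem gx)) big_cons eqxx big1_seq ?addn0 //.
  move=> z /andP[_]; rewrite (mem_rem_uniq _ (undup_uniq _)) !inE.
  by rewrite eq_sym => /andP[/negPf->].
rewrite exchange_big -sum1_size big_distrl /=; apply: eq_big_seq => z.
rewrite mem_undup => /mapP[x xs ->]; rewrite mul1n -(gk x xs).
by elim: s {xs gk} => [|y s IHs]; rewrite ?big_nil // big_cons /= IHs.
Qed.

Lemma count_split (T : Type) (p r : pred T) s :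
  count p s = (count (fun x => p x && r x) s + count (fun x => p x && ~~ r x) s)%N.
Proof. by elim: s => //= x s ->; case: (p x); case: (r x) => /=; lia. Qed.

Lemma card_eq_seq (T : choiceType) (A : set T) (s : seq T) :
  uniq s -> (forall x, A x <-> x \in s) -> (A #= `I_(size s))%card.
Proof.
move=> us As; have -> : A = [set` [fset x in s]%fset]%classic.
  by apply/seteqP; split=> x /=; rewrite inE /= => /As.
by apply/card_eq_fsetP; rewrite card_fseq undup_id.
Qed.

Variables (F : finFieldType) (vT : vectType F).
Local Notation q := #|F|.

Definition vects : seq vT := enum (finvect_type vT).

Lemma vects_uniq : uniq vects. Proof. exact: enum_uniq. Qed.

Lemma mem_vects x : x \in vects.
Proof. by rewrite (mem_enum (finvect_type vT)). Qed.

Lemma count_vects (U : {vspace vT}) : count (mem U) vects = (q ^ \dim U)%N.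
Proof.
(* [vT] is taken apart because [card_vspace] wants a vector space class on a finite carrier, here
   [finvect_type]. *)
rewrite -size_filter /vects; move: U; case: vT => T cT U.
rewrite -(@card_vspace F (finvect_type (Vector.Pack cT)) cT U) cardE.
by rewrite /enum_mem -filter_predI; congr size; apply: eq_filter => x;
  rewrite /= andbT.
Qed.

Lemma size_vects : size vects = (q ^ \dim {:vT})%N.
Proof.
by rewrite -count_vects -(count_predT vects); apply: eq_count => x; rewrite /= memvf.
Qed.

Lemma count_nonzero (U : {vspace vT}) :
  count (fun x => (x \in U) && (x != 0)) vects = (q ^ \dim U - 1)%N.
Proof.
have := count_split (mem U) (pred1 0) vects; rewrite count_vects => ->.
have -> : count (fun y => mem U y && pred1 0 y) vects = 1%N.
  transitivity (count (mem (0%VS : {vspace vT})) vects).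
    2: by rewrite count_vects dimv0.
  apply: eq_count => y /=; rewrite memv0.
  by apply: andb_idl => /eqP->; rewrite mem0v.
by rewrite addKn.
Qed.

Definition indep_pairs (U : {vspace vT}) : seq (vT * vT) :=
  [seq p <- [seq (x, y) | x <- vects, y <- vects]
     | [&& p.1 \in U, p.2 \in U & indep p.1 p.2]].

Lemma indep_pairs_uniq U : uniq (indep_pairs U).
Proof. by rewrite filter_uniq ?allpairs_uniq ?vects_uniq // => -[? ?] []. Qed.

Lemma mem_indep_pairs U p :
  (p \in indep_pairs U) = [&& p.1 \in U, p.2 \in U & indep p.1 p.2].
Proof.
rewrite mem_filter andb_idr // => _; case: p => x y.
by apply/allpairsP; exists (x, y); rewrite !mem_vects.
Qed.

Lemma size_indep_pairs U :
  size (indep_pairs U) = ((q ^ \dim U - 1) * (q ^ \dim U - q))%N.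
Proof.
rewrite size_filter count_allpairs /=.
transitivity (\sum_(x <- vects | (x \in U) && (x != 0%R)) (q ^ \dim U - q))%N.
  rewrite [RHS]big_mkcond; apply: eq_bigr => x _ /=.
  rewrite /indep; case: (boolP (x \in U)) => xU /=; last by rewrite count_pred0.
  case: (eqVneq x 0) => [_|x0] /=.
    by rewrite -(count_pred0 vects); apply: eq_count => y; rewrite /= andbF.
  have := count_split (mem U) (mem <[x]>%VS) vects.
  rewrite count_vects => ->.
  have -> : count (fun y => mem U y && mem <[x]>%VS y) vects = q.
    rewrite -[RHS]expn1; have <- : \dim <[x]> = 1%N by rewrite dim_vline x0.
    rewrite -count_vects; apply: eq_count => y /=.
    apply: andb_idl => /vlineP[k ->]; exact: memvZ.
  by rewrite addKn.
rewrite big_const_seq iter_addn_0 mulnC; congr (_ * _)%N.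
exact: count_nonzero.
Qed.

Definition planes2 : seq {vspace vT} :=
  undup [seq (<[p.1]> + <[p.2]>)%VS | p <- indep_pairs fullv].

Lemma mem_planes2 U : (U \in planes2) = (\dim U == 2).
Proof.
rewrite mem_undup; apply/mapP/eqP => [[p]|/dim2P[a [b [ab ->]]]].
  by rewrite mem_indep_pairs => /and3P[_ _ pi] ->; rewrite dim_line2.
by exists (a, b); rewrite ?mem_indep_pairs /= ?memvf.
Qed.

(** Each 2-dimensional subspace has (q^2 - 1)(q^2 - q) ordered bases, so the span map on independent
    pairs has fibres of constant size. *)
Lemma size_planes2 : ((q ^ \dim {:vT} - 1) * (q ^ \dim {:vT} - q)
  = size planes2 * ((q ^ 2 - 1) * (q ^ 2 - q)))%N.
Proof.
rewrite -size_indep_pairs; apply: size_fibers => -[a b].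
rewrite mem_indep_pairs /= => /and3P[_ _ ab].
rewrite -(dim_line2 ab) -size_indep_pairs -size_filter.
apply/perm_size/uniq_perm; rewrite ?(filter_uniq _ (indep_pairs_uniq _)) ?indep_pairs_uniq //.
move=> [c d]; rewrite mem_filter !mem_indep_pairs /= !memvf /=.
apply/andP/and3P => [[/eqP<- cd]|[cU dU cd]]; first by rewrite mem_line2l mem_line2r.
by rewrite (line2_eq _ cd cU dU) ?dim_line2.
Qed.

End Counting.

(** * Line parallelisms of PG(3, q) *)

Section Frobenius.

Variables (F : finFieldType) (L : fieldExtType F).
Local Notation q := #|F|.
Implicit Types (x y : L).

Lemma frobD x y : (x + y) ^+ q = x ^+ q + y ^+ q.
Proof. by have := exprq_is_linear (L := L) 1 1 x y; rewrite expn1 !scale1r. Qed.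

Lemma frobZ (k : F) x : (k *: x) ^+ q = k *: x ^+ q.
Proof. by rewrite exprZn expf_card. Qed.

Lemma frobN x : (- x) ^+ q = - x ^+ q.
Proof. by rewrite -scaleN1r frobZ scaleN1r. Qed.

Lemma q_gt1 : (1 < q)%N. Proof. exact: finNzRing_gt1. Qed.

Lemma q_gt0 : (0 < q)%N. Proof. exact: ltnW q_gt1. Qed.

Lemma frob0 : (0 : L) ^+ q = 0.
Proof. by rewrite expr0n gtn_eqF ?q_gt0. Qed.

Lemma exprq x : x ^+ q = x * x ^+ q.-1.
Proof. by rewrite -exprS prednK ?q_gt0. Qed.

(** Over [F] the polynomial X^q - X is the product of all X - k, so a root in [L] is one of the
    scalars k. *)
Lemma frob_fixed x : x ^+ q = x -> x \in <[1]>%VS.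
Proof.
move=> xq.
have : (map_poly (in_alg L) ('X^q - 'X)).[x] == 0.
  by rewrite rmorphB /= map_polyXn map_polyX !hornerE xq subrr.
rewrite finField_genPoly rmorph_prod /= horner_prod => /prodf_eq0[k _].
rewrite rmorphB /= map_polyX map_polyC /= !hornerE subr_eq0 => /eqP->.
by apply/vlineP; exists k.
Qed.

Lemma expf_dim x : x ^+ (q ^ \dim {:L}) = x.
Proof.
have -> : (q ^ \dim {:L})%N = #|finvect_type L| by rewrite -size_vects [RHS]cardT.
exact: (@expf_card (finvect_type L) x).
Qed.

End Frobenius.

(** * Linear isomorphisms and the field of order q^2 *)

Section LinearIso.

Import passmx.

Variables (K : fieldType) (uT vT : vectType K).

Lemma injective_hom : \dim {:uT} = \dim {:vT} -> exists f : 'Hom(uT, vT), lker f == 0%VS.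
Proof.
move=> duv; set e := vbasis {:uT}; set e' := vbasis {:vT}.
exists (hommx e e' (pid_mx (\dim {:uT}))).
rewrite -subv0; apply/subvP => u; rewrite memv_ker memv0 hommxE ?vbasisP //
  vecof_eq0 ?vbasisP // => /eqP pu.
have rf : row_free (pid_mx (\dim {:uT}) : 'M[K]_(\dim {:uT}, \dim {:vT})).
  by rewrite /row_free rank_pid_mx ?duv.
have : rVof e u == 0 by apply/eqP/(row_free_inj rf); rewrite /= mul0mx.
by rewrite rVof_eq0 ?vbasisP.
Qed.

End LinearIso.

Section QuadraticExtension.

Variable F : finFieldType.

(** The map t^2 + t takes the value 0 at both 0 and -1, so on a finite field it misses some c; then
    X^2 + X - c has no root. This works in every characteristic. *)
Lemma quadratic_extension : exists K : fieldExtType F, \dim {:K} = 2%N.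
Proof.
have /existsP[c /forallP cP] : [exists c : F, [forall t : F, t ^+ 2 + t != c]].
  rewrite -[[exists _, _]]negbK; apply/negP => /existsPn H.
  have {}H c : exists t : F, t ^+ 2 + t == c.
    by have := H c => /forallPn[t]; rewrite negbK; exists t.
  pose g c := xchoose (H c).
  have gK : cancel g (fun t => t ^+ 2 + t) by move=> c; apply/eqP/(xchooseP (H c)).
  have := canF_sym gK; move=> /(_ (-1)); have := canF_sym gK 0.
  rewrite sqrrN expr1n subrr expr0n addr0 => -> /eqP.
  by rewrite eq_sym oppr_eq0 oner_eq0.
have sz : size ('X^2 + ('X - c%:P)) = 3%N.
  by rewrite size_polyDl ?size_polyXn ?size_XsubC.
have irr : irreducible_poly ('X^2 + ('X - c%:P)).
  apply: cubic_irreducible; first by rewrite sz.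
  by move=> x; rewrite rootE !hornerE /= subr_eq0.
have [K dK _] := irredp_FAdjoin irr; by exists K; rewrite dK sz.
Qed.

End QuadraticExtension.

(** * The unit circle of the field of order q^2 *)

Section Parallelism.

Variables (F : finFieldType) (K : fieldExtType F).
Hypothesis dimK : \dim {:K} = 2%N.
Local Notation q := #|F|.

Lemma frobK (x : K) : (x ^+ q) ^+ q = x.
Proof. by rewrite -exprM mulnn -dimK expf_dim. Qed.

(** This is x^(q^2 - 1) = 1, read as: x^(q-1) has norm 1. *)
Lemma expq1D1 (x : K) : x != 0 -> (x ^+ q.-1) ^+ q * x ^+ q.-1 = 1.
Proof.
move=> x0; apply: (mulfI (expf_neq0 q x0)); rewrite mulr1 mulrA -exprMn -exprq.
by rewrite frobK -exprq.
Qed.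

Lemma exists_notin_base : exists x : K, x \notin <[1]>%VS.
Proof.
have [|x _ xN] := @exists_notin F K fullv <[1]>; last by exists x.
by rewrite dimK dim_vline; case: eqP.
Qed.

Lemma expq1_neq1 (x : K) : x \notin <[1]>%VS -> x ^+ q.-1 != 1.
Proof.
by apply: contraNneq => x1; apply: frob_fixed; rewrite exprq x1 mulr1.
Qed.

(* The points x^(q-1) form the unit circle U, of size q + 1.  As z lies off U on
   the line joining 1 and u, at most q of the q + 1 directions at z meet U. *)
Lemma external_line (t : F) : t != 0 -> t != 1 ->
  exists c0 e : K, e != 0 /\ forall (x : K) (r : F), x != 0 -> x ^+ q.-1 <> c0 + r *: e.
Proof.
move=> t0 t1; have [w wN] := exists_notin_base.
have w0 : w != 0 by apply: contraNneq wN => ->; rewrite mem0v.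
pose u := w ^+ q.-1; have u1 : u != 1 := expq1_neq1 wN.
have uu : u ^+ q * u = 1 := expq1D1 w0.
pose z := 1 + t *: (u - 1); exists z.
have zN (x : K) : x != 0 -> x ^+ q.-1 <> z.
  move=> /expq1D1 + xz; rewrite xz; apply/eqP; rewrite -subr_eq0.
  (* The norm of z differs from 1, since t, 1 - t and u - 1 are nonzero. *)
  have -> : z ^+ q * z - 1 = (t * (1 - t))%:A * (u ^+ q * (u - 1) ^+ 2).
    rewrite /z frobD frobZ frobD frobN expr1n -(mulr_algl t (u - 1)).
    rewrite -(mulr_algl t (u ^+ q - 1)) -scalerA scalerBl scale1r.
    rewrite -(mulr_algl t (1 - _)).
    by move: (u ^+ q) (t%:A) uu => U T uu; ring: uu.
  have uq0 : u ^+ q != 0 by rewrite !expf_neq0.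
  rewrite mulf_neq0 ?mulf_neq0 ?expf_neq0 ?subr_eq0 //.
  by rewrite scaler_eq0 oner_eq0 orbF mulf_neq0 // subr_eq0 eq_sym.
pose U := undup [seq x ^+ q.-1 | x <- [seq x <- vects K | x != 0]].
have memU (x : K) : x != 0 -> x ^+ q.-1 \in U.
  move=> x0; rewrite mem_undup; apply/mapP; exists x; last by [].
  by rewrite mem_filter x0 mem_vects.
have sU : (size U <= q.+1)%N.
  have sp : size ('X^(q.+1) - 1%:P : {poly K}) = q.+2 by rewrite size_XnsubC.
  rewrite -ltnS -sp; apply: max_poly_roots (undup_uniq _).
    by rewrite -size_poly_eq0 sp.
  apply/allP => v; rewrite mem_undup => /mapP[y]; rewrite mem_filter => /andP[y0 _].
  move=> ->; rewrite rootE !hornerE subr_eq0 /= exprS mulrC.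
  by rewrite (expq1D1 y0).
apply: contrapT => H.
(* A pair (v, k) stands for the vector k (v - z). If every direction at z met the circle, at most (q
   + 1)(q - 1) pairs would have to reach all q^2 - 1 nonzero vectors. *)
pose g (p : K * F) := p.2 *: (p.1 - z).
pose ps := [seq (x, k) | x <- U, k <- [seq k <- enum F | k != 0]].
have memps (x : K) (k : F) : x != 0 -> k != 0 -> (x ^+ q.-1, k) \in ps.
  move=> x0 k0; apply/allpairsP; exists (x ^+ q.-1, k).
  by split=> //=; [exact: memU | rewrite mem_filter k0 mem_enum].
(* The points 1 and u are collinear with z; the factors make both vectors equal to (1 - t)(u - 1).
   One of the two pairs can thus be dropped, and the count fails by one. *)
pose p0 := (1 : K, (t - 1) / t); pose p1 := (u, 1 : F).
have p0in : p0 \in ps.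
  have := memps 1 ((t - 1) / t); rewrite expr1n; apply; first exact: oner_neq0.
  by rewrite mulf_neq0 ?invr_eq0 ?subr_eq0.
have p1in : p1 \in ps by rewrite memps ?oner_eq0.
have p01 : p0 != p1 by rewrite xpair_eqE eq_sym (negPf u1).
have gp01 : g p0 = g p1.
  rewrite /g /z /= scale1r opprD addNKr -scalerN scalerA mulrAC -mulrA divff //.
  by rewrite mulr1 opprB scalerBl scale1r -opprB scalerN; ring.
pose ps' := rem p1 ps; pose s := [seq x <- vects K | x != 0].
have ss : size s = (q ^ 2 - 1)%N.
  have := count_predC (pred1 0) (vects K).
  rewrite size_vects dimK count_uniq_mem ?vects_uniq // mem_vects => <-.
  by rewrite addKn size_filter.
have sps : (size ps <= q ^ 2 - 1)%N.
  have -> : (q ^ 2 - 1 = q.+1 * q.-1)%N by have := q_gt0 F; nia.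
  rewrite size_allpairs; apply: leq_mul => //.
  rewrite size_filter; have := count_predC (pred1 (0 : F)) (enum F).
  rewrite -cardE count_uniq_mem ?enum_uniq // mem_enum inE => <-.
  by rewrite add1n.
have: (size s <= size [seq g p | p <- ps'])%N.
  apply: uniq_leq_size; first by rewrite filter_uniq ?vects_uniq.
  move=> e; rewrite mem_filter => /andP[e0 _].
  have [x [r [x0 xr]]] : exists (x : K) (r : F), x != 0 /\ x ^+ q.-1 = z + r *: e.
    apply: contrapT => N; apply: H; exists e; split=> // x r x0 xr.
    by apply: N; exists x, r.
  have r0 : r != 0.
    apply/eqP => r0; apply: (zN x x0); by rewrite xr r0 scale0r addr0.
  have -> : e = g (x ^+ q.-1, r^-1).
    by rewrite /g /= xr [z + _]addrC addrK scalerA mulVf ?scale1r.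
  have : (x ^+ q.-1, r^-1) \in ps by rewrite memps ?invr_eq0.
  case: (eqVneq (x ^+ q.-1, r^-1) p1) => [->|pn] pin; apply/mapP.
    by exists p0; rewrite ?gp01 // rem_mem.
  by exists (x ^+ q.-1, r^-1); rewrite // rem_mem.
rewrite size_map ss size_rem //.
have : (0 < size ps)%N by case: (ps) p1in.
have : (1 < q ^ 2)%N by rewrite (ltn_exp2l 0 2) ?q_gt1.
by move: (q ^ 2)%N (size ps) sps => n m; lia.
Qed.

End Parallelism.

(** * Spreads of K * K indexed by the lines of a projective plane *)

Section Classes.

Variables (F : finFieldType) (K : fieldExtType F).
Hypothesis dimK : \dim {:K} = 2%N.
Local Notation q := #|F|.

(* sigma = 0 if q > 2; if q = 2, then the third condition is void. *)
Lemma line_shift : exists (c0 e : K) (sigma : K -> K),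
  [/\ e != 0,
      forall (x : K) (r s : F), x != 0 -> s != 0 ->
        x ^+ q.-1 <> c0 + r *: e + s *: (e * sigma x),
      forall (x : K) (r s : F), x != 0 -> s != 0 -> s != 1 ->
        x ^+ q.-1 <> c0 + r *: e,
      forall (x : K) (s : F), s != 0 -> sigma (s *: x) = sigma x &
      forall (x : K) (s : F), s != 0 -> (1 - s) *: sigma x = 0].
Proof.
case: (pselect (exists2 t : F, t != 0 & t != 1)) => [[t t0 t1]|F2].
  have [c0 [e [e0 ext]]] := external_line dimK t0 t1.
  exists c0, e, (fun=> 0); split=> // *; rewrite ?mulr0 ?scaler0 ?addr0 //; exact: ext.
have s1 (s : F) : s != 0 -> s = 1.
  by move=> s0; apply/eqP; apply: contra_notT F2 => s1; exists s.
have q2 : q = 2%N.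
  rewrite -[q]/#|{: F}| (eq_card (B := [pred k in [:: 0; 1 : F]])).
    by rewrite cardE /= -[RHS]/(size [:: 0; 1 : F]); apply/perm_size/uniq_perm;
      rewrite ?enum_uniq //= ?inE ?andbT 1?eq_sym ?oner_eq0 // => k; rewrite mem_enum.
  by move=> k; rewrite !inE; case: (eqVneq k 0) => //= /s1->; rewrite eqxx.
have [th thN] := exists_notin_base dimK.
(* For q = 2 the power x^(q-1) is x itself and s = 1: an x in [F] is never r + th, and an x outside
   [F] is never r. *)
exists 0, 1, (fun x => if x \in <[1]>%VS then th else 0); rewrite q2 oner_eq0.
split=> // [x r s x0 s0|x r s _ /s1->|x s /s1->|x s /s1->].
- rewrite (s1 s s0) scale1r mul1r add0r expr1; case: ifP => [x1 xE|/negP xN xE].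
    by case/negP: thN; rewrite -(addKr (r%:A) th) -xE memvD ?memvN ?memvZ ?memv_line.
  by apply: xN; rewrite xE addr0 memvZ ?memv_line.
- by rewrite eqxx.
- by rewrite scale1r.
- by rewrite subrr scale0r.
Qed.

Local Notation P := (K * K)%type.
Local Notation A := (F^o * K)%type.

Definition apair (k : F) (y : K) : A := (k, y).

(** Homogeneous coordinates: the vectors (1, y) form the affine plane [K], and this is the
    projective closure of the affine line c + F e. *)
Definition slope_line (c e : K) : {vspace A} := (<[apair 1%R c]> + <[apair 0%R e]>)%VS.

Definition infinity_line : {vspace A} := limg (linfun (@inr_fun F F^o K)).

Lemma dim_slope_line c e : e != 0 -> \dim (slope_line c e) = 2%N.
Proof.
move=> e0; apply: dim_line2; apply/andP; split.
  by apply/eqP => -[] /eqP; rewrite oner_eq0.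
apply/vlineP => -[k] [/esym/eqP]; rewrite [_ *: _]mulr1 => /eqP-> /eqP.
by rewrite scale0r (negPf e0).
Qed.

Lemma mem_infinity_line (z : A) : (z \in infinity_line) = (z.1 == 0).
Proof.
apply/memv_imgP/eqP => [[y _ ->]|]; first by rewrite lfunE.
by case: z => x y /= ->; exists y; rewrite ?memvf // lfunE.
Qed.

Lemma dim_infinity_line : \dim infinity_line = 2%N.
Proof.
rewrite limg_dim_eq ?dimK //; apply/eqP; rewrite -subv0; apply/subvP => y.
by rewrite memv_cap memv_ker lfunE /= memv0 => /andP[_ /eqP[->]].
Qed.

Lemma slope_line_neq_infinity c e : slope_line c e <> infinity_line.
Proof.
move=> E; have := mem_line2l (apair 1 c) (apair 0 e); rewrite -/(slope_line c e) E.
by rewrite mem_infinity_line oner_eq0.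
Qed.

Lemma slope_line_inj c e c' e' : e' != 0 -> slope_line c e = slope_line c' e' ->
  exists s t : F, [/\ s != 0, e' = s *: e & c' = c + t *: e].
Proof.
move=> e0 E.
have := mem_line2r (apair 1 c') (apair 0 e'); rewrite -/(slope_line c' e') -E.
case/mem_line2P=> k [s [+ es]]; rewrite [_ *: 1]mulr1 [_ *: 0]mulr0 addr0 => k0.
rewrite -k0 scale0r add0r in es.
have := mem_line2l (apair 1 c') (apair 0 e'); rewrite -/(slope_line c' e') -E.
case/mem_line2P=> l [t [+ ct]]; rewrite [_ *: 1]mulr1 [_ *: 0]mulr0 addr0 => l1.
rewrite -l1 scale1r in ct; exists s, t; split=> //.
by apply: contraNneq e0 => s0; rewrite es s0 scale0r.
Qed.

Lemma scale_in_alg (k : F) (x : K) : k *: x = in_alg K k * x.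
Proof. by rewrite mulr_algl. Qed.

Variables (c0 e : K) (sigma : K -> K).
Hypothesis e0 : e != 0.
Hypothesis sigma_shift : forall (x : K) (r s : F), x != 0 -> s != 0 ->
  x ^+ q.-1 <> c0 + r *: e + s *: (e * sigma x).
Hypothesis external : forall (x : K) (r s : F), x != 0 -> s != 0 -> s != 1 ->
  x ^+ q.-1 <> c0 + r *: e.
Hypothesis sigmaZ : forall (x : K) (s : F), s != 0 -> sigma (s *: x) = sigma x.
Hypothesis sigma_tors : forall (x : K) (s : F), s != 0 -> (1 - s) *: sigma x = 0.

Definition kstable (E : {vspace P}) :=
  forall (k : K) (z : P), z \in E -> (k * z.1, k * z.2) \in E.

Definition is_graph (c d : K) (E : {vspace P}) :=
  forall z : P, (z \in E) = (z.2 == c * z.1 + d * z.1 ^+ q).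

Definition ppair (x y : K) : P := (x, y).

(** A relation, since the third clause refers to a basis that [E] does not determine. There the
    slopes y/x + F v/x form an affine line, which is moved by [v / x * sigma x]. *)
Definition in_class (E : {vspace P}) (B : {vspace A}) :=
  [\/ kstable E /\ B = infinity_line,
      exists c d, [/\ d != 0, is_graph c d E & B = slope_line (c + d * c0) (d * e)] |
      exists x v y, [/\ x != 0, v != 0,
        E = (<[ppair x y]> + <[ppair 0%R v]>)%VS &
        B = slope_line (y / x + v / x * sigma x) (v / x)]].

Lemma dim_in_class E B : in_class E B -> \dim B = 2%N.
Proof.
case=> [[_ ->]|[c [d [d0 _ ->]]]|[x [v [y [x0 v0 _ ->]]]]].
- exact: dim_infinity_line.
- by rewrite dim_slope_line // mulf_neq0.
- by rewrite dim_slope_line // mulf_neq0 ?invr_eq0.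
Qed.

(** The intersection of [E] with 0 * K has dimension 0, 1 or 2. In dimension 0, [E] is the graph of
    an F-linear map of [K], and every such map has the form c x + d x^q; in dimension 2, [E] is 0 *
    K. *)
Lemma in_class_exists (E : {vspace P}) : \dim E = 2%N -> exists B, in_class E B.
Proof.
move=> dE; have := dim_prod_space E; rewrite dE => /esym.
have [th thN] := exists_notin_base dimK.
case df : (\dim (fiber0 E)) => [|[|[|n]]] /eqP.
- rewrite addn0 => /eqP dp.
  have pE x : exists y, ppair x y \in E.
    apply/mem_proj1v; suff -> : proj1v E = fullv by rewrite memvf.
    by apply/eqP; rewrite eqEdim subvf dimK dp.
  have fE y : ppair 0 y \in E -> y = 0.
    rewrite -mem_fiber0; move/eqP: df; rewrite dimv_eq0 => /eqP->.
    by rewrite memv0 => /eqP.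
  have [m0 m0E] := pE 1; have [m1 m1E] := pE th.
  have thq : th ^+ q - th != 0.
    by rewrite subr_eq0; apply: contraNneq thN; apply: frob_fixed.
  (* The coefficients c and d interpolate the values m0 at 1 and m1 at th. *)
  pose d := (m1 - m0 * th) / (th ^+ q - th); pose c := m0 - d.
  have cd0 : c * 1 + d * 1 ^+ q = m0 by rewrite expr1n !mulr1 subrK.
  have cd1 : c * th + d * th ^+ q = m1 by rewrite /c /d; field.
  have cdE x : ppair x (c * x + d * x ^+ q) \in E.
    have i1t : indep (1 : K) th by rewrite /indep oner_eq0.
    have : x \in (<[1]> + <[th]>)%VS.
      by rewrite (line2_eq dimK i1t) ?memvf.
    case/mem_line2P=> k [l ->].
    have -> : ppair (k *: 1 + l *: th)
        (c * (k *: 1 + l *: th) + d * (k *: 1 + l *: th) ^+ q)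
        = k *: ppair 1 m0 + l *: ppair th m1.
      rewrite -cd0 -cd1 frobD !frobZ; congr (_, _) => /=.
      by rewrite !scale_in_alg; ring.
    by rewrite memvD ?memvZ.
  have gE : is_graph c d E.
    move=> [x y] /=; apply/idP/eqP => [xyE|->]; last exact: cdE.
    apply/eqP; rewrite -subr_eq0; apply/eqP/fE.
    have -> : ppair 0 (y - (c * x + d * x ^+ q)) = (x, y) - ppair x (c * x + d * x ^+ q).
      by congr (_, _); rewrite /= subrr.
    by rewrite memvB.
  have [d0|d0] := eqVneq d 0.
    exists infinity_line; apply: Or31; split=> // k [x y].
    by rewrite !gE d0 /= !mul0r !addr0 => /eqP->; rewrite mulrCA.
  by exists (slope_line (c + d * c0) (d * e)); apply: Or32; exists c, d.
- rewrite addn1 eqSS => /eqP dp.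
  have [v v0 fv] := dim1P df; have [x x0 px] := dim1P dp.
  have /mem_proj1v[y xyE] : x \in proj1v E by rewrite px memv_line.
  exists (slope_line (y / x + v / x * sigma x) (v / x)); apply: Or33.
  exists x, v, y; split=> //; apply/esym/line2_eq => //.
    apply/andP; split; first by apply/eqP => -[xx]; rewrite xx eqxx in x0.
    apply/vlineP => -[k [/esym/eqP]]; rewrite scaler_eq0 (negPf x0) orbF.
    by move=> /eqP-> /eqP; rewrite scale0r (negPf v0).
  by rewrite -mem_fiber0 fv memv_line.
- rewrite -[X in _ == X]add0n eqn_add2r dimv_eq0 => /eqP p0.
  exists infinity_line; apply: Or31; split=> // k [x y] xyE /=.
  have : x \in proj1v E by apply/mem_proj1v; exists y.
  rewrite p0 memv0 => /eqP->; rewrite mulr0 -mem_fiber0.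
  suff -> : fiber0 E = fullv by rewrite memvf.
  by apply/eqP; rewrite eqEdim subvf dimK df.
- by rewrite !addnS.
Qed.

(** A [K]-stable subspace of dimension 2 over [F] consists of the [K]-multiples of z, with F-basis z
    and th z. *)
Lemma kstable_eq (E E' : {vspace P}) z : \dim E = 2%N -> \dim E' = 2%N ->
  kstable E -> kstable E' -> z != 0 -> z \in E -> z \in E' -> E = E'.
Proof.
move=> dE dE' kE kE' z0 zE zE'; have [th thN] := exists_notin_base dimK.
have iz : indep z (th * z.1, th * z.2).
  rewrite /indep z0; apply: contraNN thN => /vlineP[k [k1 k2]].
  suff -> : th = k%:A by rewrite memvZ ?memv_line.
  have [z10|z10] := eqVneq z.1 0; last first.
    by apply: (mulIf z10); rewrite k1 mulr_algl.
  have z20 : z.2 != 0.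
    by apply: contraNneq z0 => z20; apply/eqP; case: (z) z10 z20 => /= ? ? -> ->.
  by apply: (mulIf z20); rewrite k2 mulr_algl.
by rewrite -(line2_eq dE iz) ?(line2_eq dE' iz) //; [exact: kE' | exact: kE].
Qed.

(** The slope c + d x^(q-1) of a common nonzero vector would also lie on y/x + F v/x. As the index
    lines are equal, this writes x^(q-1) in the form excluded by [sigma_shift]. *)
Lemma graph_secant_trivial (E E' : {vspace P}) c d x v y z : d != 0 -> is_graph c d E ->
    x != 0 -> v != 0 -> E' = (<[ppair x y]> + <[ppair 0%R v]>)%VS ->
    slope_line (c + d * c0) (d * e) = slope_line (y / x + v / x * sigma x) (v / x) ->
  z \in E -> z \in E' -> z = 0.
Proof.
move=> d0 gE x0 v0 -> sl + /mem_line2P[k [l zkl]].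
have [s [t [s0 vE yE]]] := slope_line_inj (mulf_neq0 v0 (invr_neq0 x0)) sl.
rewrite gE zkl /= scaler0 addr0 frobZ exprq => /eqP zE.
have [k0|k0] := eqVneq k 0.
  move: zE; rewrite k0 !scale0r !mulr0 !add0r => lv.
  by congr (_, _); rewrite /= ?scaler0.
case: (@sigma_shift x (t + l / k * s) (- s) x0); first by rewrite oppr_eq0.
have K0 : in_alg K k != 0 by rewrite fmorph_eq0.
have yE' : y = (c + d * c0 + t *: (d * e) - s *: (d * e) * sigma x) * x.
  by rewrite -yE -vE addrK divfK.
have vE' : v = s *: (d * e) * x by rewrite -vE divfK.
move: zE; rewrite yE' vE' !scale_in_alg rmorphD !rmorphM rmorphN fmorphV /= => zE.
have dkx : d * k%:A * x != 0 by rewrite !mulf_neq0.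
apply: (mulfI dkx); move: zE K0 => /=.
move: (k%:A) (s%:A) (t%:A) (l%:A) (x ^+ _) => k' s' t' l' X zE K0.
have -> : d * k' * x * X = d * (k' * (x * X)) by ring.
rewrite -[LHS](addKr (c * (k' * x))) -zE; field.
exact: K0.
Qed.

Lemma secants_eq (E E' : {vspace P}) x v y x' v' y' z :
    \dim E' = 2%N ->
    x != 0 -> v != 0 -> E = (<[ppair x y]> + <[ppair 0%R v]>)%VS ->
    x' != 0 -> v' != 0 -> E' = (<[ppair x' y']> + <[ppair 0%R v']>)%VS ->
    slope_line (y / x + v / x * sigma x) (v / x)
      = slope_line (y' / x' + v' / x' * sigma x') (v' / x') ->
  z != 0 -> z \in E -> z \in E' -> E = E'.
Proof.
move=> dE' x0 v0 defE x0' v0' defE' sl z0 zE zE'.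
have [s [t [s0 vE yE]]] := slope_line_inj (mulf_neq0 v0' (invr_neq0 x0')) sl.
(* If k = 0, the common vector only shows that v' is a multiple of v; since v'/x' = s v/x, the same
   follows for x' and x. *)
have [r r0 xr] : exists2 r : F, r != 0 & x' = r *: x.
  move: zE zE'; rewrite defE defE'.
  move=> /mem_line2P[k [l zkl]] /mem_line2P[k' [l' zkl']].
  have [k0|k0] := eqVneq k 0.
    have : z.1 = k' *: x' by rewrite zkl' /= scaler0 addr0.
    rewrite {1}zkl k0 /= scaler0 scale0r addr0 => /esym/eqP.
    rewrite scaler_eq0 (negPf x0') orbF => /eqP k0'.
    have : z.2 = l *: v by rewrite zkl k0 /= scale0r add0r.
    rewrite {1}zkl' k0' /= scale0r add0r => lv.
    have l0' : l' != 0.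
      apply: contraNneq z0 => l0'.
      by rewrite zkl' k0' l0' !scale0r addr0.
    have l0 : l != 0.
      apply: contraNneq l0' => l0; move/eqP: lv.
      by rewrite l0 scale0r scaler_eq0 (negPf v0') orbF.
    exists (l / (l' * s)); first by rewrite !mulf_neq0 ?invr_eq0 ?mulf_neq0.
    have L0' : in_alg K l' != 0 by rewrite fmorph_eq0.
    have S0 : in_alg K s != 0 by rewrite fmorph_eq0.
    have vE' : v' = in_alg K l / in_alg K l' * v.
      by apply: (mulfI L0'); rewrite mulrA mulrCA divff // mulr1 -!scale_in_alg.
    have -> : x' = v' / (v' / x') by rewrite invf_div mulrC divfK.
    rewrite vE vE' !scale_in_alg fmorph_div rmorphM; field.
    by rewrite x0 v0 S0 L0'.
  have : z.1 = k *: x by rewrite zkl /= scaler0 addr0.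
  rewrite {1}zkl' /= scaler0 addr0 => kx.
  have k0' : k' != 0.
    apply: contraNneq k0 => k0'; move/eqP: kx.
    by rewrite k0' scale0r eq_sym scaler_eq0 (negPf x0) orbF.
  exists (k / k'); first by rewrite mulf_neq0 ?invr_eq0.
  by rewrite mulrC -scalerA -kx scalerA mulVf ?scale1r.
have vE' : v' = (s * r) *: v.
  have -> : v' = v' / x' * x' by rewrite divfK.
  by rewrite vE xr !scale_in_alg rmorphM; field.
have yE' : y' = r *: y + (r * t) *: v.
  have -> : y' = (y' / x' + v' / x' * sigma x' - v' / x' * sigma x') * x'.
    by rewrite addrK divfK.
  (* The two shifts are v/x and s v/x times [sigma x]; [sigma_tors] cancels their difference. *)
  have := sigma_tors x s0; rewrite scalerBl scale1r => /eqP; rewrite subr_eq0 => /eqP.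
  rewrite yE vE xr sigmaZ // !scale_in_alg rmorphM /= => sg.
  transitivity (r%:A * y + r%:A * t%:A * v + r%:A * v * (sigma x - s%:A * sigma x)).
    by field.
  by rewrite -sg subrr mulr0 addr0.
have i' : indep (ppair x' y') (ppair 0 v').
  by apply: dim2_indep; rewrite -defE'.
rewrite defE'; apply/esym/line2_eq => //; rewrite defE.
- apply/dim_line2/andP; split.
    by apply/eqP => -[xx]; rewrite xx eqxx in x0.
  apply/vlineP => -[k [/esym/eqP]]; rewrite scaler_eq0 (negPf x0) orbF.
  by move=> /eqP-> /eqP; rewrite scale0r (negPf v0).
- apply/mem_line2P; exists r, (r * t).
  by congr (_, _); rewrite /= ?scaler0 ?addr0.
- apply/mem_line2P; exists 0, (s * r).
  by congr (_, _); rewrite /= ?scaler0 ?scale0r ?addr0 ?add0r.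
Qed.

(** Write d' = s d. If s differs from 1, a common vector and the equality of the index lines put
    [z.1 ^+ q.-1] on c0 + F e, against [external]. If s = 1, the coefficients agree. *)
Lemma graphs_eq (E E' : {vspace P}) c d c' d' z :
    d != 0 -> is_graph c d E -> d' != 0 -> is_graph c' d' E' ->
    slope_line (c + d * c0) (d * e) = slope_line (c' + d' * c0) (d' * e) ->
  z != 0 -> z \in E -> z \in E' -> E = E'.
Proof.
move=> d0 gE d0' gE' sl z0; rewrite gE gE' => /eqP zc /eqP zc'.
have z10 : z.1 != 0.
  apply: contraNneq z0 => z10; move: zc; rewrite z10 frob0 !mulr0 addr0.
  by move: z10; case: (z) => /= ? ? -> ->.
have [s [t [s0 dE cE]]] := slope_line_inj (mulf_neq0 d0' e0) sl.
have dE' : d' = s *: d by apply: (mulIf e0); rewrite dE scalerAl.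
have zcc : (c - c') * z.1 = (d' - d) * z.1 ^+ q.
  apply/eqP; rewrite -subr_eq0.
  have -> : (c - c') * z.1 - (d' - d) * z.1 ^+ q
    = (c * z.1 + d * z.1 ^+ q) - (c' * z.1 + d' * z.1 ^+ q) by ring.
  by rewrite -zc -zc' subrr.
have [s1|s1] := eqVneq s 1.
  have dd : d' = d by rewrite dE' s1 scale1r.
  have cc : c' = c.
    move/eqP: zcc; rewrite dd subrr mul0r mulf_eq0 (negPf z10) orbF subr_eq0.
    by move/eqP.
  by apply/vspaceP => w; rewrite gE gE' cc dd.
case: (@external z.1 (t / (1 - s)) s z10 s0 s1).
have S1 : 1 - in_alg K s != 0.
  by rewrite subr_eq0 -[1](rmorph1 (in_alg K)) fmorph_eq eq_sym.
have ds : d * (1 - in_alg K s) * z.1 != 0 by rewrite !mulf_neq0.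
apply: (mulfI ds); have cE' : c' = c + d * c0 + t *: (d * e) - d' * c0.
  by rewrite -cE addrK.
transitivity (- ((d' - d) * z.1 ^+ q)).
  by rewrite dE' scale_in_alg exprq; ring.
rewrite -zcc cE' dE' !scale_in_alg fmorph_div rmorphB rmorph1; field.
exact: S1.
Qed.

Lemma in_class_disjoint (E E' : {vspace P}) B :
    \dim E = 2%N -> \dim E' = 2%N -> in_class E B -> in_class E' B ->
  E <> E' -> (E :&: E' = 0)%VS.
Proof.
move=> dE dE' EB E'B nE; apply/eqP; rewrite -subv0; apply/subvP => z.
rewrite memv_cap memv0 => /andP[zE zE']; apply: contra_notT nE => z0.
case: EB E'B.
- move=> [kE ->] [[kE' _]|[c [d [_ _ /esym/slope_line_neq_infinity//]]]|].
    exact: kstable_eq zE zE'.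
  by move=> [x [v [y [_ _ _ /esym/slope_line_neq_infinity]]]].
- move=> [c [d [d0 gE ->]]].
  move=> [[_ /slope_line_neq_infinity//]|[c' [d' [d0' gE' sl]]]|].
    exact: (graphs_eq d0 gE d0' gE' sl z0 zE zE').
  move=> [x [v [y [x0 v0 defE' sl]]]].
  by rewrite (graph_secant_trivial d0 gE x0 v0 defE' sl zE zE') eqxx in z0.
- move=> [x [v [y [x0 v0 defE ->]]]].
  move=> [[_ /slope_line_neq_infinity//]|[c [d [d0 gE' /esym sl]]]|].
    by rewrite (graph_secant_trivial d0 gE' x0 v0 defE sl zE' zE) eqxx in z0.
  move=> [x' [v' [y' [x0' v0' defE' sl]]]].
  exact: (secants_eq dE' x0 v0 defE x0' v0' defE' sl z0 zE zE').
Qed.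

End Classes.

(** The classes are transported along an isomorphism with K * K. The value of [cl] names a spread;
    there are only q^2 + q + 1 possible names, which makes the count in [class_of_pencil] tight. *)
Lemma line_parallelism (F : finFieldType) (vT : vectType F) :
    \dim {:vT} = 4%N ->
  exists (A : vectType F) (cl : {vspace vT} -> {vspace A}),
    [/\ \dim {:A} = 3%N, forall E, \dim E = 2%N -> \dim (cl E) = 2%N &
        forall E E', \dim E = 2%N -> \dim E' = 2%N -> cl E = cl E' ->
          E <> E' -> (E :&: E' = 0)%VS].
Proof.
move=> dvT; have [K dK] := quadratic_extension F.
have [c0 [e [sigma [e0 H1 H2 H3 H4]]]] := line_shift dK.
have [f f0] : exists f : 'Hom(vT, (K * K)%type), lker f == 0%VS.
  apply: injective_hom; rewrite dvT dimvf -[dim _]/(dim K + dim K)%N.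
  by rewrite -[dim K]/(dim (K : vectType F)) -!dimvf dK.
have ex (E : {vspace vT}) : exists B, \dim E = 2%N -> in_class c0 e sigma (f @: E)%VS B.
  case: (eqVneq (\dim E) 2%N) => [dE|/eqP]; last by exists 0%VS.
  have [|B EB] := in_class_exists dK c0 e sigma (E := (f @: E)%VS); last by exists B.
  by rewrite limg_dim_eq // (eqP f0) capv0.
have [cl clP] := choice ex.
have dimf (E : {vspace vT}) : \dim (f @: E) = \dim E.
  by rewrite limg_dim_eq // (eqP f0) capv0.
exists (F^o * K)%type, cl; split=> [|E dE|E E' dE dE' clE nE].
- rewrite dimvf -[dim _]/(dim F^o + dim K)%N -[dim K]/(dim (K : vectType F)).
  by rewrite -!dimvf dK dimvf.
- by apply: dim_in_class (clP _ dE).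
apply/eqP; rewrite -(eq_limg_ker0 _ _ f0) limg0 lker0_img_cap //; apply/eqP.
apply: (in_class_disjoint dK e0 H1 H2 H3 H4 _ _ (clP E dE)); rewrite ?dimf //.
  by rewrite clE; exact: clP.
by move=> /eqP; rewrite eq_limg_ker0 // => /eqP.
Qed.

(** * The plane code *)

Section Moore.

Variables (F : finFieldType) (L : fieldExtType F).
Local Notation q := #|F|.

(** The 2 by 2 Moore determinant: F-bilinear, alternating, and zero only on F-dependent pairs. *)
Definition moore (a b : L) : L := a * b ^+ q - a ^+ q * b.

Lemma mooreC a b : moore b a = - moore a b.
Proof. by rewrite /moore; ring. Qed.

Lemma moorexx a : moore a a = 0.
Proof. by rewrite /moore; ring. Qed.

Lemma mooreDl a b c : moore (a + b) c = moore a c + moore b c.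
Proof. by rewrite /moore frobD; ring. Qed.

Lemma mooreDr a b c : moore a (b + c) = moore a b + moore a c.
Proof. by rewrite /moore frobD; ring. Qed.

Lemma mooreZl (k : F) a b : moore (k *: a) b = k *: moore a b.
Proof. by rewrite /moore frobZ scalerBr !scalerAl. Qed.

Lemma mooreZr (k : F) a b : moore a (k *: b) = k *: moore a b.
Proof. by rewrite /moore frobZ scalerBr !scalerAr. Qed.

Lemma mooreBl a b c : moore (a - b) c = moore a c - moore b c.
Proof. by rewrite -scaleN1r mooreDl mooreZl scaleN1r. Qed.

Lemma moore_eq0 a b : a != 0 -> moore a b = 0 -> b \in <[a]>%VS.
Proof.
move=> a0 /eqP; rewrite subr_eq0 => /eqP ab.
have : b / a \in <[1]>%VS.
  apply: frob_fixed; rewrite expr_div_n.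
  by apply: (mulfI a0); rewrite mulrA ab mulrC mulKf ?expf_neq0 // mulrC divfK.
case/vlineP=> k bk; apply/vlineP; exists k.
by rewrite -[b](divfK a0) bk mulr_algl.
Qed.

Definition rmoore b a := moore a b.

Lemma rmoore_is_linear b : linear (rmoore b).
Proof. by move=> k x y; rewrite /rmoore mooreDl mooreZl. Qed.

HB.instance Definition _ b :=
  GRing.isLinear.Build F L L *:%R (rmoore b) (rmoore_is_linear b).

(** The vector [b] lies in the kernel. The resulting y becomes the second coordinate in a lifted
    plane. *)
Lemma moore_nonsurjective b : b != 0 -> exists y, y \notin limg (linfun (rmoore b)).
Proof.
move=> b0; have [|y _ yN] := @exists_notin F L fullv (limg (linfun (rmoore b))).
  rewrite -(limg_ker_dim (linfun (rmoore b)) fullv) capfv -[X in (X < _)%N]add0n.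
  rewrite ltn_add2r lt0n dimv_eq0; apply: contraNneq b0 => k0.
  by rewrite -memv0 -k0 memv_ker lfunE /= /rmoore moorexx.
by exists y.
Qed.

Hypothesis dimL : \dim {:L} = 4%N.

Lemma trace4_frob (x : L) : trace4 x ^+ q = trace4 x.
Proof.
have x4 : x ^+ (q ^ 3 * q) = x by rewrite -expnSr -dimL expf_dim.
by rewrite /trace4 !frobD -!exprM x4 -expnSr mulnn; ring.
Qed.

(** Otherwise a polynomial of degree q^3 would have q^4 roots. *)
Lemma trace4_neq0 : exists x : L, trace4 x != 0.
Proof.
apply: contrapT => N.
have T0 (x : L) : trace4 x = 0.
  by apply/eqP; apply: contra_notT N => xN; exists x.
pose p : {poly L} := 'X^(q ^ 3) + ('X^(q ^ 2) + ('X^q + 'X)).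
have q1 := q_gt1 F.
have sz : size p = (q ^ 3).+1.
  rewrite size_polyDl size_polyXn // ltnS.
  have lt2 : (q < q ^ 2)%N by rewrite -{1}[q]expn1 ltn_exp2l.
  have lt3 : (q ^ 2 < q ^ 3)%N by rewrite ltn_exp2l.
  rewrite size_polyDl size_polyXn // ltnS.
  by rewrite size_polyDl size_polyXn ?size_polyX // ltnS.
have p0 : p != 0 by rewrite -size_poly_eq0 sz.
have := max_poly_roots p0 _ (vects_uniq L).
rewrite sz size_vects dimL ltnS leq_exp2l //= => H.
suff: false by []; apply: H; apply/allP => x _.
have pE : p.[x] = trace4 x by rewrite !hornerE /= /trace4; ring.
by rewrite rootE pE T0.
Qed.

Local Notation W := (subvs_of (spaceW L)).

(** The trace is fixed by Frobenius, so its image lies in the line of 1, and it is nonzero; the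
    kernel thus has dimension 4 - 1. *)
Lemma dimW : \dim {:W} = 3%N.
Proof.
rewrite dimvf -[dim _]/(\dim (spaceW L)).
have := limg_ker_dim (linfun (@trace4 F L)) fullv; rewrite capfv dimL.
have : (\dim (limg (linfun (@trace4 F L))) <= 1)%N.
  have <- : \dim <[1 : L]> = 1%N by rewrite dim_vline oner_eq0.
  apply: dimvS; apply/subvP => _ /memv_imgP[x _ ->].
  by rewrite lfunE; apply: frob_fixed; exact: trace4_frob.
have : (0 < \dim (limg (linfun (@trace4 F L))))%N.
  rewrite lt0n dimv_eq0; have [x xN] := trace4_neq0.
  apply: contraNneq xN => l0; rewrite -memv0 -l0; apply/memv_imgP.
  by exists x; rewrite ?memvf ?lfunE.
by rewrite /spaceW; move: (\dim (limg _)) (\dim (lker _)) => i j; lia.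
Qed.

End Moore.

(** * The lines T_Z and the maps in G and R *)

Section Planes.

Variables (F : finFieldType) (L : fieldExtType F).
Hypothesis dimL : \dim {:L} = 4%N.
Local Notation q := #|F|.
Local Notation W := (subvs_of (spaceW L)).
Local Notation V := (spaceV L).
Implicit Types (a b u v w : W) (c g h : L).

Definition mooreW a b : L := moore (vsval a) (vsval b).

Lemma mooreW_eq0 a b : a != 0 -> mooreW a b = 0 -> b \in <[a]>%VS.
Proof.
move=> a0 /moore_eq0; rewrite -[0]/(vsval (0 : W)) (inj_eq (@subvs_inj _ _ _)).
by move/(_ a0)/vlineP=> [k bk]; apply/vlineP; exists k; apply: subvs_inj.
Qed.

Lemma mooreW_neq0 a b : indep a b -> mooreW a b != 0.
Proof. by case/andP=> a0; apply: contraNneq; apply: mooreW_eq0. Qed.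

Lemma mooreW_span a b u v : u \in (<[a]> + <[b]>)%VS -> v \in (<[a]> + <[b]>)%VS ->
  mooreW u v \in <[mooreW a b]>%VS.
Proof.
move=> /mem_line2P[k [l ->]] /mem_line2P[k' [l' ->]].
apply/vlineP; exists (k * l' - l * k').
have vE i j : vsval (i *: a + j *: b) = i *: vsval a + j *: vsval b.
  by rewrite linearD !linearZ.
rewrite /mooreW !vE !(mooreDl, mooreDr, mooreZl, mooreZr).
rewrite !moorexx (mooreC (vsval a) (vsval b)) !scaler0 add0r addr0 !scalerN !scalerA.
by rewrite -scalerBl.
Qed.

(** The vector v is chosen so that (v, u) arises from (a, b) by a matrix of determinant 1. *)
Lemma mooreW_pencil a b u : u != 0 -> u \in (<[a]> + <[b]>)%VS ->
  exists2 v, v \in (<[a]> + <[b]>)%VS & mooreW v u = mooreW a b.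
Proof.
move=> u0 /mem_line2P[k [l ul]]; rewrite ul; have [l0|l0] := eqVneq l 0.
  have k0 : k != 0.
    by apply: contraNneq u0 => k0; rewrite ul l0 k0 !scale0r addr0.
  exists (- k^-1 *: b); first by rewrite memvZ ?mem_line2r.
  rewrite l0 scale0r addr0 /mooreW !linearZ /= mooreZl mooreZr mooreC scalerN.
  by rewrite scaleNr scalerN opprK scalerA mulVf ?scale1r.
exists (l^-1 *: a); first by rewrite memvZ ?mem_line2l.
rewrite /mooreW linearD !linearZ /= mooreZl mooreDr !mooreZr moorexx scaler0 add0r.
by rewrite scalerA mulVf ?scale1r.
Qed.

(** By [mooreW_pencil], some k v in the span satisfies moore (k v) u = moore c u, so c - k v is a
    multiple of u. *)
Lemma moore_mem_span a b u c : u != 0 -> u \in (<[a]> + <[b]>)%VS ->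
    moore c (vsval u) \in <[mooreW a b]>%VS ->
  exists2 w, w \in (<[a]> + <[b]>)%VS & c = vsval w.
Proof.
move=> u0 uZ /vlineP[k cu]; have [v vZ vu] := mooreW_pencil u0 uZ.
have : moore (vsval u) (c - vsval (k *: v)) = 0.
  by rewrite mooreC mooreBl linearZ /= mooreZl cu -vu subrr oppr0.
case/moore_eq0/vlineP=> [|r rE].
  by rewrite -[0]/(vsval (0 : W)) (inj_eq (@subvs_inj _ _ _)).
exists (r *: u + k *: v); first by rewrite memvD ?memvZ.
have -> : vsval (r *: u + k *: v) = r *: vsval u + vsval (k *: v).
  by rewrite linearD linearZ.
by rewrite -rE subrK.
Qed.

(** The two planes of the 3-space [W] share some u. A v' of the second one with moore v' u = moore
    a' b' then lies in the first by [moore_mem_span], so both are spanned by u and v'. *)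
Lemma mooreW_inj a b a' b' : indep a b -> indep a' b' ->
  mooreW a' b' \in <[mooreW a b]>%VS -> (<[a']> + <[b']>)%VS = (<[a]> + <[b]>)%VS.
Proof.
move=> ab ab' /vlineP[k m']; set Z := (<[a]> + <[b]>)%VS.
have dZ := dim_line2 ab; have dZ' := dim_line2 ab'.
have : (0 < \dim ((<[a']> + <[b']>) :&: Z))%N.
  have := dimv_sum_cap (<[a']> + <[b']>)%VS Z; rewrite dZ dZ'.
  have := dimvS (subvf ((<[a']> + <[b']>) + Z)%VS); rewrite dimW //; lia.
rewrite lt0n dimv_eq0 -vpick0; have := memv_pick ((<[a']> + <[b']>) :&: Z)%VS.
move: (vpick _) => u; rewrite memv_cap => /andP[uZ' uZ] u0.
have [v' vZ' vu'] := mooreW_pencil u0 uZ'.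
have [|w wZ /subvs_inj vw] := @moore_mem_span a b u (vsval v') u0 uZ.
  by rewrite -[moore _ _]/(mooreW v' u) vu' m' memvZ ?memv_line.
apply: (eq_dim_cap dZ' dZ); rewrite -[2%N](@dim_line2 _ _ u v').
  apply: dimvS; rewrite subv_add -!memvE !memv_cap uZ' uZ vZ' vw wZ.
  by [].
rewrite /indep u0; apply: contraNN (mooreW_neq0 ab') => /vlineP[r vr].
by rewrite -vu' vr /mooreW linearZ /= mooreZl moorexx scaler0.
Qed.

Lemma exists_indepW : exists a b, indep a b.
Proof.
have [a [b [ab _]]] : exists a b, indep a b /\ (<[a]> + <[b]> <= fullv)%VS.
  have [|a _ a0] := @exists_notin F W fullv 0; first by rewrite dimv0 dimW.
  rewrite memv0 in a0.
  have [|b _ bN] := @exists_notin F W fullv <[a]>; first by rewrite dim_vline a0 dimW.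
  by exists a, b; rewrite /indep a0 subvf.
by exists a, b.
Qed.

Definition qpoly (g0 g1 : L) (x : W) : L := g0 * vsval x + g1 * vsval x ^+ q.

Lemma qpoly_is_linear g0 g1 : linear (qpoly g0 g1).
Proof.
move=> k x y; rewrite /qpoly linearP /= frobD frobZ.
by rewrite !mulrDr -!scalerAr scalerDr; ring.
Qed.

HB.instance Definition _ g0 g1 :=
  GRing.isLinear.Build F W L *:%R (qpoly g0 g1) (qpoly_is_linear g0 g1).

Definition homG g0 g1 : 'Hom(W, L) := linfun (qpoly g0 g1).
(** [R] is the part of [G] with g0 = - g1^q; this condition is what singles out the removed
    graphs. *)
Definition homR c : 'Hom(W, L) := homG (- c ^+ q) c.

Lemma homGE g0 g1 x : homG g0 g1 x = g0 * vsval x + g1 * vsval x ^+ q.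
Proof. by rewrite lfunE. Qed.

Lemma homRE c x : homR c x = moore c (vsval x).
Proof. by rewrite homGE /moore mulNr addrC. Qed.

(** The linear system for the differences of coefficients has rows (u, u^q) and (v, v^q), and its
    determinant [mooreW u v] is nonzero. *)
Lemma homG_inj2 g0 g1 h0 h1 u v : indep u v ->
    homG g0 g1 u = homG h0 h1 u -> homG g0 g1 v = homG h0 h1 v ->
  g0 = h0 /\ g1 = h1.
Proof.
move=> uv; rewrite !homGE => eu ev.
have lin (s x : L) : g0 * x + g1 * s = h0 * x + h1 * s ->
    (g0 - h0) * x = - (g1 - h1) * s.
  move=> E; apply/eqP; rewrite -subr_eq0; apply/eqP.
  transitivity ((g0 * x + g1 * s) - (h0 * x + h1 * s)); first by ring.
  by rewrite E subrr.
have {}eu := lin _ _ eu; have {}ev := lin _ _ ev.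
have m0 := mooreW_neq0 uv.
have e1 : (g1 - h1) * mooreW u v = 0.
  rewrite /mooreW /moore mulrBr.
  have -> : (g1 - h1) * (vsval u * vsval v ^+ q) = - vsval u * (- (g1 - h1) * vsval v ^+ q) by ring.
  have -> : (g1 - h1) * (vsval u ^+ q * vsval v) = - vsval v * (- (g1 - h1) * vsval u ^+ q) by ring.
  by rewrite -eu -ev; ring.
move/eqP: e1; rewrite mulf_eq0 (negPf m0) orbF subr_eq0 => /eqP e1; split=> //.
move/eqP: eu; rewrite e1 subrr oppr0 mul0r mulf_eq0 subr_eq0.
case/orP=> [/eqP//|]; rewrite -[0]/(vsval (0 : W)) (inj_eq (@subvs_inj _ _ _)).
by case/andP: uv => /negPf->.
Qed.

Lemma homG_inj g0 g1 h0 h1 : homG g0 g1 = homG h0 h1 -> g0 = h0 /\ g1 = h1.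
Proof. by have [u [v uv]] := exists_indepW => E; apply: (homG_inj2 uv); rewrite E. Qed.

Lemma calGP f : calG L f <-> exists g0 g1, f = homG g0 g1.
Proof.
split=> [[g0 [g1 fE]]|[g0 [g1 ->]]]; exists g0, g1; last exact: homGE.
by apply/lfunP => x; rewrite homGE fE.
Qed.

Lemma calRP f : calR L f <-> exists c, f = homR c.
Proof.
split=> [[c fE]|[c ->]]; exists c; last exact: homRE.
by apply/lfunP => x; rewrite homRE fE.
Qed.

End Planes.

(** * Intersections of the planes of the code *)

Section Code.

Variables (F : finFieldType) (L : fieldExtType F).
Hypothesis dimL : \dim {:L} = 4%N.
Local Notation q := #|F|.
Local Notation W := (subvs_of (spaceW L)).
Local Notation V := (spaceV L).
Implicit Types (a b u v w x : W) (c g h y : L) (f : 'Hom(W, L)) (U : {vspace V}).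

Lemma cap_fiber0_trivial (U U' : {vspace V}) : fiber0 U = 0%VS ->
  \dim (U :&: U') = \dim (proj1v (U :&: U')).
Proof. by move=> U0; rewrite dim_prod_space fiber0_cap U0 cap0v dimv0 addn0. Qed.

Lemma proj1v_Gamma f : proj1v (Gamma f) = fullv.
Proof.
apply/vspaceP => x; rewrite memvf; apply/mem_proj1v.
by exists (f x); rewrite mem_Gamma.
Qed.

Lemma fiber0_Gamma f : fiber0 (Gamma f) = 0%VS.
Proof. by apply/vspaceP => y; rewrite mem_fiber0 mem_Gamma linear0 memv0. Qed.

Lemma dim_Gamma f : \dim (Gamma f) = 3%N.
Proof. by rewrite dim_prod_space proj1v_Gamma fiber0_Gamma dimv0 dimW. Qed.

Lemma Gamma_inj : injective (@Gamma F W L).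
Proof.
move=> f f' E; apply/lfunP => x; apply/eqP.
by rewrite -[_ == _]/((x, f x).2 == f' (x, f x).1) -mem_Gamma -E mem_Gamma.
Qed.

Definition planeN a b c : {vspace V} :=
  spaceN <[mooreW a b]> (restr (<[a]> + <[b]>)%VS (homR c)).

Lemma mem_planeN a b c (z : V) : (z \in planeN a b c) =
  (z.1 \in (<[a]> + <[b]>)%VS) && (z.2 - moore c (vsval z.1) \in <[mooreW a b]>%VS).
Proof.
apply/mem_spaceN/andP => [[x [y yT ->]]|[z1 z2]] /=.
  by rewrite subvsP restrE homRE addrAC subrr add0r.
exists (Subvs z1), (z.2 - moore c (vsval z.1)) => //.
by rewrite restrE homRE addrC subrK /=; case: (z).
Qed.

Lemma proj1v_planeN a b c : proj1v (planeN a b c) = (<[a]> + <[b]>)%VS.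
Proof.
apply/vspaceP => x; apply/mem_proj1v/idP => [[y]|xZ].
  by rewrite mem_planeN => /andP[].
by exists (moore c (vsval x)); rewrite mem_planeN xZ /= subrr mem0v.
Qed.

Lemma fiber0_planeN a b c : fiber0 (planeN a b c) = <[mooreW a b]>%VS.
Proof.
apply/vspaceP => y; rewrite mem_fiber0 mem_planeN -homRE.
by rewrite [(0, y).1]/= linear0 subr0 mem0v.
Qed.

Lemma dim_planeN a b c : indep a b -> \dim (planeN a b c) = 3%N.
Proof.
move=> ab; rewrite dim_prod_space proj1v_planeN fiber0_planeN dim_line2 //.
by rewrite dim_vline mooreW_neq0.
Qed.

Lemma mem_proj1v_cap_planeN a b c x (U : {vspace V}) :
  x \in proj1v (U :&: planeN a b c) ->
  x \in (<[a]> + <[b]>)%VS /\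
  exists2 y, (x, y) \in U & y - moore c (vsval x) \in <[mooreW a b]>%VS.
Proof.
case/mem_proj1v=> y; rewrite memv_cap mem_planeN /= => /and3P[xyU xZ yT].
by split=> //; exists y.
Qed.

Lemma dim_cap_Gamma g0 g1 h0 h1 : homG g0 g1 <> homG h0 h1 :> 'Hom(W, L) ->
  (\dim (Gamma (homG g0 g1 : 'Hom(W, L)) :&: Gamma (homG h0 h1)) <= 1)%N.
Proof.
move=> gh; rewrite cap_fiber0_trivial ?fiber0_Gamma //.
have E x : x \in proj1v (Gamma (homG g0 g1 : 'Hom(W, L)) :&: Gamma (homG h0 h1)) ->
    homG g0 g1 x = homG h0 h1 x.
  by case/mem_proj1v=> y; rewrite memv_cap !mem_Gamma => /andP[/eqP<- /eqP].
apply: dim_le1 => u v /E eu /E ev; apply: contra_notN gh => uv.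
by have [-> ->] := homG_inj2 uv eu ev.
Qed.

(** If the projection contained independent u and v, the map would agree on both with some moore c',
    hence lie in [R]. *)
Lemma dim_cap_Gamma_planeN g0 g1 a b c : indep a b -> g0 <> - g1 ^+ q ->
  (\dim (Gamma (homG g0 g1 : 'Hom(W, L)) :&: planeN a b c) <= 1)%N.
Proof.
move=> ab gN; rewrite cap_fiber0_trivial ?fiber0_Gamma //.
apply: dim_le1 => u v.
case/mem_proj1v_cap_planeN=> uZ [_ /[!mem_Gamma]/eqP/= -> uT].
case/mem_proj1v_cap_planeN=> vZ [_ /[!mem_Gamma]/eqP/= -> vT].
apply: contra_notN gN => uv; have Zuv := line2_eq (dim_line2 ab) uv uZ vZ.
have Tuv : <[mooreW a b]>%VS = <[mooreW u v]>%VS.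
  apply/esym/eqP; rewrite eqEdim !dim_vline !mooreW_neq0 // -memvE andbT.
  exact: mooreW_span.
move: uT vT; rewrite Tuv => /vlineP[k uk] /vlineP[l vl].
(* This correction changes the value at u by k moore u v and the value at v by l moore u v. *)
pose c' := c + (l *: vsval u - k *: vsval v).
suff [-> ->] : g0 = - c' ^+ q /\ g1 = c' by [].
apply: (homG_inj2 uv); rewrite -/(homR c') homRE mooreDl mooreBl !mooreZl moorexx.
  rewrite scaler0 sub0r (mooreC (vsval u) (vsval v)) scalerN opprK.
  rewrite -[moore (vsval u) _]/(mooreW u v) -uk.
  by rewrite addrC subrK.
by rewrite scaler0 subr0 -[moore (vsval u) _]/(mooreW u v) -vl addrC subrK.
Qed.

(** If c' - c lies in the span, then moore c and moore c' differ there only by values in the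
    fibre. *)
Definition same_planeN a b c a' b' c' :=
  (<[a']> + <[b']>)%VS = (<[a]> + <[b]>)%VS /\
  exists2 w, w \in (<[a]> + <[b]>)%VS & c' - c = vsval w.

Lemma mooreW_line_eq a b a' b' : indep a b -> indep a' b' ->
  (<[a']> + <[b']>)%VS = (<[a]> + <[b]>)%VS -> <[mooreW a' b']>%VS = <[mooreW a b]>%VS.
Proof.
move=> ab ab' Z; apply/eqP; rewrite eqEdim !dim_vline !mooreW_neq0 // -memvE andbT.
by apply: mooreW_span; rewrite -Z ?mem_line2l ?mem_line2r.
Qed.

Lemma same_planeN_eq a b c a' b' c' : indep a b -> indep a' b' ->
  same_planeN a b c a' b' c' -> planeN a' b' c' = planeN a b c.
Proof.
move=> ab ab' [Z [w wZ cw]]; have T := mooreW_line_eq ab ab' Z.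
apply/vspaceP => z; rewrite !mem_planeN Z T.
case: (boolP (z.1 \in _)) => //= z1.
have wz : moore (vsval w) (vsval z.1) \in <[mooreW a b]>%VS by apply: mooreW_span.
rewrite -[c'](subrK c) cw mooreDl opprD addrCA addrC.
by rewrite rpredBr.
Qed.

(** Over the same span, a common point with nonzero projection forces c' - c into the span by
    [moore_mem_span], so only the fibre remains. Over different spans the fibres meet trivially by
    [mooreW_inj], and the projections meet in dimension at most 1. *)
Lemma dim_cap_planeN a b c a' b' c' : indep a b -> indep a' b' ->
  ~ same_planeN a b c a' b' c' -> (\dim (planeN a' b' c' :&: planeN a b c) <= 1)%N.
Proof.
move=> ab ab' N; rewrite dim_prod_space fiber0_cap !fiber0_planeN.
have [Z|Z] := eqVneq (<[a']> + <[b']>)%VS (<[a]> + <[b]>)%VS.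
  have T := mooreW_line_eq ab ab' Z.
  have -> : proj1v (planeN a' b' c' :&: planeN a b c) = 0%VS.
    apply/eqP; rewrite -subv0; apply/subvP => x /mem_proj1v_cap_planeN[xZ [y + yT]].
    rewrite mem_planeN /= memv0 T => /andP[_ yT'].
    apply: contra_notT N => x0; split=> //.
    apply: (moore_mem_span x0 xZ); rewrite mooreBl.
    have -> : moore c' (vsval x) - moore c (vsval x)
      = (y - moore c (vsval x)) - (y - moore c' (vsval x)) by ring.
    by rewrite memvB.
  rewrite dimv0 add0n (leq_trans (dimvS (capvSl _ _))) // dim_vline; by case: (_ != 0).
have -> : (<[mooreW a' b']> :&: <[mooreW a b]> = 0)%VS.
  apply/eqP; rewrite -subv0; apply/subvP => t; rewrite memv_cap memv0.
  case/andP=> /vlineP[k ->] kT; apply: contraNT Z; rewrite scaler_eq0 negb_or.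
  case/andP=> k0 _; apply/eqP/(mooreW_inj dimL ab ab').
  by rewrite -[mooreW _ _](scalerK k0) memvZ.
rewrite dimv0 addn0 (leq_trans (dimvS (proj1v_cap _ _))) // !proj1v_planeN.
rewrite leqNgt; apply: contraNN Z => d2; apply/eqP.
exact: eq_dim_cap (dim_line2 ab') (dim_line2 ab) d2.
Qed.

Lemma planeN_eqP a b c a' b' c' : indep a b -> indep a' b' ->
  planeN a' b' c' = planeN a b c <-> same_planeN a b c a' b' c'.
Proof.
move=> ab ab'; split; last exact: same_planeN_eq.
move=> E; apply: contrapT => /(dim_cap_planeN ab ab').
by rewrite E capvv dim_planeN.
Qed.

Lemma added_planesP U :
  added_planes L U <-> exists a b c, indep a b /\ U = planeN a b c.
Proof.
split=> [[Z [a [b [f [dZ defZ /calRP[c ->] ->]]]]]|[a [b [c [ab ->]]]]].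
  exists a, b, c; split; first by apply: dim2_indep; rewrite -defZ.
  by rewrite defZ.
exists (<[a]> + <[b]>)%VS, a, b, (homR c); split=> //; first exact: dim_line2.
by apply/calRP; exists c.
Qed.

End Code.

(** * Gaussian binomial identities *)

Section Arithmetic.

Local Open Scope nat_scope.
Variable q : nat.
Hypothesis q1 : 1 < q.

Lemma gauss_pos : 0 < (q ^ 2 - 1) * (q ^ 2 - q).
Proof.
by rewrite muln_gt0 !subn_gt0 (ltn_exp2l 0) // -{1}[q]expn1 ltn_exp2l.
Qed.

Lemma sub1_pow3 : q ^ 3 - 1 = (q - 1) * (q ^ 2 + q + 1).
Proof.
have -> : q = (q - 1).+1 by lia.
by rewrite subSS subn0; move: (q - 1) => k; rewrite -[RHS](addnK 1); congr (_ - 1); ring.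
Qed.

Lemma gauss3 : (q ^ 3 - 1) * (q ^ 3 - q)
  = (q ^ 2 + q + 1) * ((q ^ 2 - 1) * (q ^ 2 - q)).
Proof.
have e3 : q ^ 3 - q = q * (q ^ 2 - 1) by rewrite mulnBr muln1 -expnS.
have e2 : q ^ 2 - q = q * (q - 1) by rewrite mulnBr muln1 mulnn.
by rewrite e3 e2 sub1_pow3; ring.
Qed.

Lemma gauss4 : (q ^ 4 - 1) * (q ^ 4 - q)
  = ((q ^ 2 + 1) * (q ^ 2 + q + 1)) * ((q ^ 2 - 1) * (q ^ 2 - q)).
Proof.
have e4 : q ^ 4 - q = q * (q ^ 3 - 1) by rewrite mulnBr muln1 -expnS.
have e2 : q ^ 2 - q = q * (q - 1) by rewrite mulnBr muln1 mulnn.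
have f4 : q ^ 4 - 1 = (q ^ 2 - 1) * (q ^ 2 + 1) by rewrite -(subn_sqr (q ^ 2) 1) -expnM.
by rewrite e4 e2 f4 sub1_pow3; ring.
Qed.

End Arithmetic.

Section SubspaceCounts.

Variables (F : finFieldType) (vT : vectType F).
Local Notation q := #|F|.

Lemma size_planes2_dim3 : \dim {:vT} = 3%N -> size (planes2 vT) = (q ^ 2 + q + 1)%N.
Proof.
move=> d3; have := size_planes2 vT; rewrite d3 gauss3 ?q_gt1 // => /eqP.
by rewrite eqn_pmul2r ?gauss_pos ?q_gt1 // => /eqP.
Qed.

Lemma size_planes2_dim4 : \dim {:vT} = 4%N ->
  size (planes2 vT) = ((q ^ 2 + 1) * (q ^ 2 + q + 1))%N.
Proof.
move=> d4; have := size_planes2 vT; rewrite d4 gauss4 ?q_gt1 // => /eqP.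
by rewrite eqn_pmul2r ?gauss_pos ?q_gt1 // => /eqP.
Qed.

Lemma count_translate (U : {vspace vT}) (c : vT) :
  count (fun x => x - c \in U) (vects vT) = (q ^ \dim U)%N.
Proof.
rewrite -count_vects -(count_map (fun x => x - c) (mem U)); apply/permP/uniq_perm.
- by rewrite map_inj_uniq ?vects_uniq //; exact: subIr.
- exact: vects_uniq.
by move=> x; rewrite mem_vects; apply/mapP; exists (x + c); rewrite ?mem_vects ?addrK.
Qed.

End SubspaceCounts.

(** * The size of the code *)

Section Counts.

Variables (F : finFieldType) (L : fieldExtType F).
Hypothesis dimL : \dim {:L} = 4%N.
Local Notation q := #|F|.
Local Notation W := (subvs_of (spaceW L)).
Local Notation V := (spaceV L).
Implicit Types (a b u v w x : W) (c g h y : L) (f : 'Hom(W, L)) (U : {vspace V}).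

Definition graph_planes : seq {vspace V} :=
  [seq Gamma (homG p.2 p.1 : 'Hom(W, L))
     | p <- [seq p : L * L <- [seq (c, g) | c <- vects L, g <- vects L]
                   | p.2 != - p.1 ^+ q]].

Lemma graph_planes_uniq : uniq graph_planes.
Proof.
rewrite map_inj_uniq; last first.
  by move=> [c g] [c' g'] /Gamma_inj /(homG_inj dimL)[/= -> ->].
by rewrite filter_uniq ?allpairs_uniq ?vects_uniq // => -[? ?] [].
Qed.

Lemma mem_graph_planes U : U \in graph_planes <->
  exists g c, g <> - c ^+ q /\ U = Gamma (homG g c : 'Hom(W, L)).
Proof.
split=> [/mapP[[c g]]|[g [c [/eqP gN ->]]]].
  by rewrite mem_filter /= => /andP[/eqP gN _] ->; exists g, c.
apply/mapP; exists (c, g); rewrite // mem_filter gN /=.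
by apply/allpairsP; exists (c, g); rewrite !mem_vects.
Qed.

Lemma mem_graph_planes_calL U : U \in graph_planes <->
  (calL L `\` [set Gamma f | f in calR L])%classic U.
Proof.
rewrite mem_graph_planes; split.
  move=> [g [c [gN ->]]]; split; first by exists (homG g c) => //; apply/calGP; exists g, c.
  move=> [f /calRP[c' ->] /Gamma_inj /(homG_inj dimL)[E cc]].
  by apply: gN; rewrite -E cc.
move=> [[f /calGP[g [c ->]] <-] N]; exists g, c; split=> // gE; apply: N.
by exists (homR c); [apply/calRP; exists c | rewrite gE].
Qed.

Lemma size_graph_planes : size graph_planes = (q ^ 4 * (q ^ 4 - 1))%N.
Proof.
rewrite size_map size_filter count_allpairs /=.
have E c : count (fun g : L => g != - c ^+ q) (vects L) = (q ^ 4 - 1)%N.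
  have := count_predC (pred1 (- c ^+ q)) (vects L).
  by rewrite size_vects dimL count_uniq_mem ?vects_uniq // mem_vects => <-; rewrite addKn.
under eq_bigr => c _ do rewrite E.
by rewrite big_const_seq iter_addn_0 count_predT size_vects dimL mulnC.
Qed.

Definition planeN_params : seq (W * W * L) :=
  [seq (p, c) | p <- indep_pairs {:W}, c <- vects L].

Definition new_planes : seq {vspace V} :=
  undup [seq planeN p.1.1 p.1.2 p.2 | p <- planeN_params].

Lemma mem_new_planes U :
  U \in new_planes <-> exists a b c, indep a b /\ U = planeN a b c.
Proof.
rewrite mem_undup; split=> [/mapP[[p c] /allpairsP[[p' c'] [/= pP _ [-> ->]]] ->]|].
  by exists p'.1, p'.2, c'; move: pP; rewrite mem_indep_pairs => /and3P[].
move=> [a [b [c [ab ->]]]]; apply/mapP; exists ((a, b), c) => //.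
apply/allpairsP; exists ((a, b), c); split=> //=; last exact: mem_vects.
by rewrite mem_indep_pairs /= !memvf.
Qed.

(** By [planeN_eqP], each plane arises from (q^2 - 1)(q^2 - q) ordered bases of its projection and,
    for each of them, from the q^2 values of c in one coset of that projection. *)
Lemma size_new_planes : size new_planes = (q ^ 2 * (q ^ 2 + q + 1))%N.
Proof.
have fibers : forall p, p \in planeN_params ->
    count (fun r : W * W * L => planeN r.1.1 r.1.2 r.2 == planeN p.1.1 p.1.2 p.2)
      planeN_params = (((q ^ 2 - 1) * (q ^ 2 - q)) * q ^ 2)%N.
  move=> [[a b] c] /allpairsP[[[a' b'] c'] [/= + _ [-> -> ->]]].
  rewrite mem_indep_pairs /= => /and3P[_ _ ab] {a b c}.
  set Z := (<[a']> + <[b']>)%VS; have dZ : \dim Z = 2%N := dim_line2 ab.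
  rewrite count_allpairs /=.
  transitivity (\sum_(p <- indep_pairs {:W} | (p.1 \in Z) && (p.2 \in Z)) q ^ 2)%N.
    rewrite [RHS]big_mkcond; apply: eq_big_seq => -[u v].
    rewrite mem_indep_pairs /= => /and3P[_ _ uv].
    have {}E c : (planeN u v c == planeN a' b' c') =
        ((u \in Z) && (v \in Z)) && (c - c' \in linfun vsval @: Z)%VS.
      apply/eqP/andP.
        move/(planeN_eqP dimL _ _ ab uv)=> [uvZ [w wZ cw]].
        rewrite -/Z in uvZ wZ; rewrite -uvZ mem_line2l mem_line2r; split=> //.
        by apply/memv_imgP; exists w; [rewrite uvZ | rewrite lfunE].
      case=> /andP[uZ vZ] /memv_imgP[w wZ cw].
      apply/(planeN_eqP dimL _ _ ab uv); split; first exact: line2_eq.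
      by exists w => //; rewrite cw lfunE.
    under eq_count => c do rewrite E.
    case: (_ && _); last by rewrite count_pred0.
    rewrite count_translate limg_dim_eq ?dZ //; apply/eqP; rewrite -subv0.
    apply/subvP => w; rewrite memv_cap memv_ker lfunE memv0 => /andP[_].
    by rewrite -[0 in X in X -> _]/(vsval (0 : W)) (inj_eq (@subvs_inj _ _ _)).
  rewrite big_const_seq iter_addn_0 mulnC; congr (_ * _)%N.
  have := size_indep_pairs Z; rewrite dZ => <-; rewrite -size_filter.
  apply/perm_size/uniq_perm.
  - by rewrite filter_uniq ?indep_pairs_uniq.
  - exact: indep_pairs_uniq.
  by move=> [u v]; rewrite mem_filter !mem_indep_pairs /= !memvf /= andbA.
have := size_fibers fibers.
rewrite size_allpairs size_indep_pairs size_vects dimL dimW // -/new_planes.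
rewrite gauss3 ?q_gt1 // => /eqP.
have -> : ((q ^ 2 + q + 1) * ((q ^ 2 - 1) * (q ^ 2 - q)) * q ^ 4
  = (q ^ 2 * (q ^ 2 + q + 1)) * ((q ^ 2 - 1) * (q ^ 2 - q) * q ^ 2))%N by ring.
rewrite eqn_pmul2r; first by move/eqP.
by rewrite muln_gt0 gauss_pos ?q_gt1 // expn_gt0 q_gt0.
Qed.

Definition code_planes := graph_planes ++ new_planes.

Lemma mem_code_planes U : calC L U <-> U \in code_planes.
Proof.
rewrite mem_cat; split.
  case=> [/mem_graph_planes_calL->//|/added_planesP/mem_new_planes->].
  by rewrite orbT.
case/orP=> [/mem_graph_planes_calL|/mem_new_planes/added_planesP]; by [left|right].
Qed.

Lemma code_planes_uniq : uniq code_planes.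
Proof.
rewrite cat_uniq graph_planes_uniq undup_uniq andbT; apply/hasPn => U.
move=> /mem_new_planes[a [b [c [ab ->]]]]; apply/negP.
move=> /mem_graph_planes[g [d [_ /(congr1 (@fiber0 _ _ _))]]].
rewrite fiber0_Gamma fiber0_planeN => T0; have := mooreW_neq0 ab.
by rewrite -memv0 -T0 memv_line.
Qed.

Lemma size_code_planes : size code_planes = (q ^ 8 + q ^ 3 + q ^ 2)%N.
Proof.
rewrite size_cat size_graph_planes size_new_planes.
(* The q^4 graphs lost with [R] are made up by the term q^4 in the number of added planes. *)
have : (q ^ 4 * (q ^ 4 - 1) + q ^ 4 = q ^ 8)%N.
  by rewrite mulnBr muln1 -expnD subnK // leq_exp2l ?q_gt1.
by move=> <-; ring.
Qed.

Lemma calC_cases U : calC L U ->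
  (exists g c, g <> - c ^+ q /\ U = Gamma (homG g c : 'Hom(W, L))) \/
  (exists a b c, indep a b /\ U = planeN a b c).
Proof.
move/mem_code_planes; rewrite mem_cat => /orP[/mem_graph_planes|/mem_new_planes].
  by left.
by right.
Qed.

Lemma calC_code : plane_code (calC L).
Proof.
split=> [U /calC_cases[[g [c [_ ->]]]|[a [b [c [ab ->]]]]]|].
- by rewrite dim_Gamma.
- exact: dim_planeN.
move=> U U' /calC_cases[[g [c [gN ->]]]|[a [b [c [ab ->]]]]].
  move=> /calC_cases[[g' [c' [gN' ->]]]|[a [b [c' [ab ->]]]]] N.
    by apply: dim_cap_Gamma => // E; apply: N; rewrite E.
  exact: dim_cap_Gamma_planeN.
move=> /calC_cases[[g' [c' [gN' ->]]]|[a' [b' [c' [ab' ->]]]]] N.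
  by rewrite capvC; apply: dim_cap_Gamma_planeN.
rewrite capvC; apply: dim_cap_planeN => // S; apply: N.
by apply/esym/same_planeN_eq.
Qed.

End Counts.

(** * The augmentation *)

Section Augmentation.

Variables (F : finFieldType) (L : fieldExtType F).
Hypothesis dimL : \dim {:L} = 4%N.
Local Notation q := #|F|.
Local Notation W := (subvs_of (spaceW L)).
Local Notation V := (spaceV L).
Implicit Types (a b u v w x : W) (c g h y : L) (f : 'Hom(W, L)) (U : {vspace V})
  (E : {vspace L}).

(** The space M_x: for nonzero x, the union of the lines T_Z over the 2-dimensional Z through x. *)
Definition pencil x : {vspace L} := limg (homR (vsval x) : 'Hom(W, L)).

Lemma mem_pencil x w : mooreW x w \in pencil x.
Proof. by rewrite -[mooreW x w]homRE memv_img ?memvf. Qed.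

Lemma mem_pencilr x w : mooreW w x \in pencil x.
Proof. by rewrite /mooreW mooreC memvN mem_pencil. Qed.

Lemma dim_pencil x : x != 0 -> \dim (pencil x) = 2%N.
Proof.
move=> x0; have := limg_ker_dim (homR (vsval x) : 'Hom(W, L)) fullv.
have -> : (fullv :&: lker (homR (vsval x)) = <[x]> :> {vspace W})%VS.
  apply/vspaceP => w; rewrite memv_cap memvf memv_ker homRE.
  apply/eqP/vlineP => [/(mooreW_eq0 x0)/vlineP//|[k ->]].
  by rewrite linearZ /= mooreZr moorexx scaler0.
by rewrite dim_vline x0 dimW // -/(pencil x) => -[].
Qed.

(** If x and x' were independent, take w outside their span. The line T of the span of x' and w lies
    in M_x, so it is also that of a span through x. By [mooreW_inj] the two spans agree, and w lies
    in the span of x and x'. *)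
Lemma pencil_eq x x' : x != 0 -> pencil x = pencil x' -> x' \in <[x]>%VS.
Proof.
move=> x0 E; apply: contraT => x'N; have xx' : indep x x' by rewrite /indep x0.
have [|w _ wN] := @exists_notin F W fullv (<[x]> + <[x']>); first by rewrite dim_line2 ?dimW.
have x'0 := indep_neq0r xx'.
have ix'w : indep x' w.
  by rewrite /indep x'0; apply: contraNN wN; rewrite !memvE => /subv_trans-> //; exact: addvSr.
have := mem_pencil x' w; rewrite -E => /memv_imgP[w' _].
rewrite homRE -[moore _ (vsval w')]/(mooreW x w') => mE.
have ixw' : indep x w'.
  rewrite /indep x0; apply: contraNN (mooreW_neq0 ix'w) => /vlineP[k wk].
  by rewrite mE wk /mooreW linearZ /= mooreZr moorexx scaler0.
have Z : (<[x']> + <[w]>)%VS = (<[x]> + <[w']>)%VS.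
  by apply: (mooreW_inj dimL ixw' ix'w); rewrite mE memv_line.
case/negP: wN; have <- : (<[x']> + <[w]>)%VS = (<[x]> + <[x']>)%VS.
  apply/esym/line2_eq; rewrite ?dim_line2 ?mem_line2l //.
  by rewrite Z mem_line2l.
exact: mem_line2r.
Qed.

Lemma pencil_line x x' : x != 0 -> x' != 0 -> x' \in <[x]>%VS -> pencil x' = pencil x.
Proof.
move=> x0 x'0 /vlineP[k xk]; apply/eqP; rewrite eqEdim !dim_pencil // leqnn andbT.
apply/subvP => _ /memv_imgP[w _ ->]; rewrite homRE xk linearZ /= mooreZl.
by rewrite memvZ ?mem_pencil.
Qed.

Lemma pencil_meet x x' : x != 0 -> x' != 0 -> (pencil x :&: pencil x' != 0)%VS.
Proof.
move=> x0 x'0; have [xx'|xx'] := boolP (x' \in <[x]>%VS).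
  by rewrite (pencil_line x0) // capvv -dimv_eq0 dim_pencil.
have i : indep x x' by rewrite /indep x0.
have := mooreW_neq0 i; apply: contraNneq => C0.
by rewrite -memv0 -C0 memv_cap mem_pencil mem_pencilr.
Qed.

Definition lifted x y E : {vspace V} :=
  (linfun (@inr_fun F W L) @: E + <[(x, y) : V]>)%VS.

Lemma mem_lifted x y E (z : V) :
  reflect (exists2 k : F, z.1 = k *: x & z.2 - k *: y \in E) (z \in lifted x y E).
Proof.
apply: (iffP memv_addP) => [[_ /memv_imgP[t tE ->] [_ /vlineP[k ->] ->]]|[k z1 z2]].
  by exists k; rewrite lfunE /= ?add0r ?addrK.
exists (0, z.2 - k *: y); first by apply/memv_imgP; exists (z.2 - k *: y); rewrite ?lfunE.
exists (k *: (x, y) : V); first by rewrite memvZ ?memv_line.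
by case: z z1 {z2} => z1 z2 /= ->; congr (_, _); rewrite /= ?add0r ?subrK.
Qed.

Lemma proj1v_lifted x y E : proj1v (lifted x y E) = <[x]>%VS.
Proof.
apply/vspaceP => w; apply/mem_proj1v/vlineP => [[t /mem_lifted[k /= -> _]]|[k ->]].
  by exists k.
by exists (k *: y); apply/mem_lifted; exists k; rewrite //= subrr mem0v.
Qed.

Lemma fiber0_lifted x y E : x != 0 -> fiber0 (lifted x y E) = E.
Proof.
move=> x0; apply/vspaceP => t; rewrite mem_fiber0.
apply/mem_lifted/idP => [[k /= /esym/eqP]|tE].
  by rewrite scaler_eq0 (negPf x0) orbF => /eqP->; rewrite scale0r subr0.
by exists 0; rewrite /= !scale0r ?subr0.
Qed.

Lemma dim_lifted x y E : x != 0 -> \dim E = 2%N -> \dim (lifted x y E) = 3%N.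
Proof.
by move=> x0 dE; rewrite dim_prod_space proj1v_lifted fiber0_lifted // dim_vline x0 dE.
Qed.

Lemma dim_lifted_cap_spaceS x y E : x != 0 -> \dim (lifted x y E :&: spaceS L) = \dim E.
Proof.
move=> x0; rewrite dim_prod_space fiber0_cap fiber0_lifted //.
have -> : fiber0 (spaceS L) = fullv.
  by apply/vspaceP => t; rewrite mem_fiber0 mem_spaceS memvf eqxx.
have -> : proj1v (lifted x y E :&: spaceS L) = 0%VS.
  apply/eqP; rewrite -subv0; apply/subvP => w /mem_proj1v[t].
  by rewrite memv_cap mem_spaceS memv0 => /andP[].
by rewrite dimv0 capvf.
Qed.

Lemma dim_proj1v_cap_lifted x y E (U : {vspace V}) :
  (\dim (proj1v (lifted x y E :&: U)) <= 1)%N.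
Proof.
apply: leq_trans (dimvS (proj1v_cap _ _)) _; rewrite proj1v_lifted.
by apply: leq_trans (dimvS (capvSl _ _)) _; rewrite dim_vline; case: (_ != 0).
Qed.

Lemma dim_cap_lifted_Gamma x y E f : (\dim (lifted x y E :&: Gamma f) <= 1)%N.
Proof.
rewrite dim_prod_space fiber0_cap fiber0_Gamma capv0 dimv0 addn0.
exact: dim_proj1v_cap_lifted.
Qed.

(** If [E] misses T_Z, only the projection, inside the line of x, remains. If [E] contains T_Z, a
    nonzero common projection puts x into Z, whence T_Z lies in M_x, [E] equals M_x, and the choice
    of y is contradicted. *)
Lemma dim_cap_lifted_planeN x y E a b c :
    x != 0 -> y \notin limg (linfun (rmoore (vsval x))) ->
    E = pencil x \/ (E :&: pencil x)%VS = 0%VS -> indep a b ->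
  (\dim (lifted x y E :&: planeN a b c) <= 1)%N.
Proof.
move=> x0 yN EM ab; rewrite dim_prod_space fiber0_cap fiber0_lifted // fiber0_planeN.
have [mE|mN] := boolP (mooreW a b \in E); last first.
  have -> : (E :&: <[mooreW a b]> = 0)%VS.
    apply/eqP; rewrite -subv0; apply/subvP => t; rewrite memv_cap memv0.
    case/andP=> + /vlineP[k tk]; rewrite tk => kE; apply: contraNT mN.
    rewrite scaler_eq0 negb_or => /andP[k0 _].
    by rewrite -[mooreW _ _](scalerK k0) memvZ.
  by rewrite dimv0 addn0 dim_proj1v_cap_lifted.
suff -> : proj1v (lifted x y E :&: planeN a b c) = 0%VS.
  rewrite dimv0 add0n; apply: leq_trans (dimvS (capvSr _ _)) _.
  by rewrite dim_vline; case: (_ != 0).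
apply/eqP; rewrite -subv0; apply/subvP => w /mem_proj1v_cap_planeN[wZ [t]].
case/mem_lifted=> k /= wk tE tT; rewrite memv0; apply: contraT => w0.
have k0 : k != 0 by apply: contraNneq w0 => k0; rewrite wk k0 scale0r.
have xZ : x \in (<[a]> + <[b]>)%VS by rewrite -[x](scalerK k0) -wk memvZ.
have [v _ vx] := mooreW_pencil x0 xZ.
have mM : mooreW a b \in pencil x by rewrite -vx mem_pencilr.
case: EM => [EM|EM]; last first.
  by have := mooreW_neq0 ab; rewrite -memv0 -EM memv_cap mE mM.
have MH : (pencil x <= limg (linfun (rmoore (vsval x))))%VS.
  apply/subvP => _ /memv_imgP[u _ ->]; rewrite homRE mooreC memvN.
  by apply/memv_imgP; exists (vsval u); rewrite ?memvf // lfunE.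
case/negP: yN; rewrite -[y](scalerK k0) memvZ //.
(* The three terms lie in T_Z, in the image of [rmoore x], and in E = M_x; all are contained in that
   image. *)
have -> : k *: y = (t - moore c (vsval w)) + moore c (vsval w) - (t - k *: y) by ring.
apply: memvB; last by apply: (subvP MH); rewrite -EM.
apply: memvD.
  by apply: (subvP MH); case/vlineP: tT => r ->; rewrite memvZ.
rewrite wk linearZ /= mooreZr memvZ //.
by apply/memv_imgP; exists c; rewrite ?memvf // lfunE.
Qed.

(** Either the fibres are disjoint, or the planes lie over different points and only the
    intersection of distinct 2-dimensional fibres remains. *)
Lemma dim_cap_lifted x y E x' y' E' : x != 0 -> x' != 0 ->
    \dim E = 2%N -> \dim E' = 2%N -> E <> E' ->
    (E :&: E')%VS = 0%VS \/ x' \notin <[x]>%VS ->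
  (\dim (lifted x y E :&: lifted x' y' E') <= 1)%N.
Proof.
move=> x0 x'0 dE dE' N; rewrite dim_prod_space fiber0_cap !fiber0_lifted //.
case=> [->|x'N]; first by rewrite dimv0 addn0 dim_proj1v_cap_lifted.
have -> : proj1v (lifted x y E :&: lifted x' y' E') = 0%VS.
  apply/eqP; rewrite -subv0; apply/subvP => w /(subvP (proj1v_cap _ _)).
  rewrite !proj1v_lifted memv_cap memv0 => /andP[wx /vlineP[k wk]].
  apply: contraNT x'N => w0; have k0 : k != 0.
    by apply: contraNneq w0 => k0; rewrite wk k0 scale0r.
  by rewrite -[x'](scalerK k0) -wk memvZ.
rewrite dimv0 add0n leqNgt; apply: contra_notN N; exact: eq_dim_cap.
Qed.

(** * The spaces M_x as representatives of the spreads *)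

Section Lifting.

Variables (A : vectType F) (cl : {vspace L} -> {vspace A}).
Hypothesis dimA : \dim {:A} = 3%N.
Hypothesis dim_cl : forall E, \dim E = 2%N -> \dim (cl E) = 2%N.
Hypothesis cl_disjoint : forall E E', \dim E = 2%N -> \dim E' = 2%N ->
  cl E = cl E' -> E <> E' -> (E :&: E' = 0)%VS.

(** Since any two M_x meet, those of different points have different classes. The q^3 - 1 nonzero
    vectors thus give q^2 + q + 1 classes, as many as there are 2-dimensional subspaces of [A], so
    each is hit. *)
Lemma class_of_pencil (B : {vspace A}) : \dim B = 2%N ->
  exists2 x, x != 0 & cl (pencil x) = B.
Proof.
move=> dB; pose s := [seq x <- vects W | x != 0].
have cl_inj x x' : x != 0 -> x' != 0 ->
    (cl (pencil x') == cl (pencil x)) = (x' \in <[x]>%VS).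
  move=> x0 x'0; apply/eqP/idP => [E|/(pencil_line x0 x'0)->//].
  apply: (pencil_eq x0); apply: contrapT => N.
  have := pencil_meet x0 x'0; rewrite (cl_disjoint _ _ _ N) ?eqxx //; exact: dim_pencil.
have := @size_fibers _ _ (fun x => cl (pencil x)) s (q - 1).
have -> : size s = (q ^ 3 - 1)%N.
  rewrite size_filter -(dimW dimL) -count_nonzero; apply: eq_count => x.
  by rewrite memvf.
rewrite sub1_pow3 ?q_gt1 // mulnC => sf.
have {}sf : size (undup [seq cl (pencil x) | x <- s]) = (q ^ 2 + q + 1)%N.
  apply/esym/eqP; rewrite -(@eqn_pmul2r (q - 1)) ?subn_gt0 ?q_gt1 //; apply/eqP/sf.
  move=> x; rewrite mem_filter => /andP[x0 _].
  have <- : (q ^ \dim <[x]> - 1 = q - 1)%N by rewrite dim_vline x0 expn1.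
  rewrite -count_nonzero /s count_filter; apply: eq_count => x' /=.
  by case: (eqVneq x' 0) => [->|x'0]; rewrite ?andbF //= !andbT cl_inj.
have sub : {subset undup [seq cl (pencil x) | x <- s] <= planes2 A}.
  move=> C; rewrite mem_undup => /mapP[x]; rewrite mem_filter => /andP[x0 _] ->.
  by rewrite mem_planes2 dim_cl ?dim_pencil.
have [|_ E] := uniq_min_size (undup_uniq _) sub; first by rewrite sf size_planes2_dim3.
have := E B; rewrite mem_planes2 dB eqxx mem_undup => /mapP[x].
by rewrite mem_filter => /andP[x0 _] ->; exists x.
Qed.

End Lifting.

Lemma code_extension : exists D : seq {vspace V},
  [/\ uniq D, size D = ((q ^ 2 + 1) * (q ^ 2 + q + 1))%N,
      forall U, U \in D -> \dim U = 3%N /\ \dim (U :&: spaceS L) = 2%N,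
      {in D &, forall U U', U <> U' -> (\dim (U :&: U') <= 1)%N} &
      forall U U', U \in D -> calC L U' -> (\dim (U :&: U') <= 1)%N].
Proof.
have [A [cl [dA dcl clD]]] := line_parallelism dimL.
(* Made total for [choice], with default value 0 outside dimension 2; likewise for y at x = 0. *)
have xex B : exists x, \dim B = 2%N -> x != 0 /\ cl (pencil x) = B.
  case: (eqVneq (\dim B) 2%N) => [dB|/eqP]; last by exists 0.
  by have [x x0 xB] := class_of_pencil dA dcl clD dB; exists x.
have [xx xxP] := choice xex.
have yex x : exists y, x != 0 -> y \notin limg (linfun (rmoore (vsval x))).
  case: (eqVneq x 0) => [|x0]; first by exists 0.
  have [|y yN] := @moore_nonsurjective F L (vsval x); last by exists y.
  by rewrite -[0]/(vsval (0 : W)) (inj_eq (@subvs_inj _ _ _)).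
have [yy yyP] := choice yex.
pose U E := lifted (xx (cl E)) (yy (xx (cl E))) E.
have xP E : \dim E = 2%N -> xx (cl E) != 0 /\ cl (pencil (xx (cl E))) = cl E.
  by move=> dE; apply/xxP/dcl.
have Ucap E E' : \dim E = 2%N -> \dim E' = 2%N -> E <> E' ->
    (\dim (U E :&: U E') <= 1)%N.
  move=> dE dE' N; have [x0 xE] := xP E dE; have [x0' xE'] := xP E' dE'.
  (* Subspaces in one spread are disjoint; those in different spreads are lifted over different
     points. *)
  apply: dim_cap_lifted => //; have [eE|nE] := eqVneq (cl E) (cl E').
    by left; apply: clD.
  right; apply: contraNN nE => /(pencil_line x0 x0') pE.
  by rewrite -xE -xE' pE.
have U3 E : \dim E = 2%N -> \dim (U E) = 3%N.
  by move=> dE; have [x0 _] := xP E dE; rewrite dim_lifted.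
exists [seq U E | E <- planes2 L]; split.
- rewrite map_inj_in_uniq ?undup_uniq // => E E'.
  rewrite !mem_planes2 => /eqP dE /eqP dE' EU; apply: contrapT => /(Ucap _ _ dE dE').
  by rewrite EU capvv U3.
- by rewrite size_map size_planes2_dim4.
- move=> _ /mapP[E + ->]; rewrite mem_planes2 => /eqP dE; split; first exact: U3.
  by have [x0 _] := xP E dE; rewrite dim_lifted_cap_spaceS.
- move=> _ _ /mapP[E + ->] /mapP[E' + ->]; rewrite !mem_planes2 => /eqP dE /eqP dE' N.
  by apply: Ucap => // EE; apply: N; rewrite EE.
move=> _ U' /mapP[E + ->]; rewrite mem_planes2 => /eqP dE; have [x0 xE] := xP E dE.
case/(calC_cases dimL)=> [[g [c [_ ->]]]|[a [b [c [ab ->]]]]].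
  exact: dim_cap_lifted_Gamma.
apply: dim_cap_lifted_planeN => //; first exact: yyP.
(* [E] and M_x belong to the same spread, hence are equal or disjoint. *)
have [EM|N] := eqVneq E (pencil (xx (cl E))); first by left.
by right; apply: clD; rewrite ?dim_pencil //; apply/eqP.
Qed.

End Augmentation.

Local Close Scope ring_scope.
Local Open Scope classical_set_scope.
Local Open Scope card_scope.

Theorem theorem4p2 (q : nat) (F : finFieldType) (L : fieldExtType F)
    (cardF : #|F| = q) (dimL : \dim {:L} = 4) :
  [/\ plane_code (calC L),
      calC L #= `I_(q ^ 8 + q ^ 3 + q ^ 2) &
      exists D : set {vspace spaceV L},
        [/\ D #= `I_(q ^ 4 + q ^ 3 + 2 * q ^ 2 + q + 1),
            calC L `&` D = set0,
            forall U, D U -> \dim (U :&: spaceS L) = 2,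
            plane_code (calC L `|` D) &
            calC L `|` D
              #= `I_(q ^ 8 + q ^ 4 + 2 * q ^ 3 + 3 * q ^ 2 + q + 1)]].
Proof.
rewrite -cardF; have [D [uD sD DS DD DC]] := code_extension dimL.
(* A common plane would meet itself in dimension at most 1. *)
have C_notin_D U : calC L U -> U \in D -> False.
  move=> CU DU; have := DC U U DU CU.
  by have [d3 _] := DS U DU; rewrite capvv d3.
have code := calC_code dimL.
have sizeD : size D = (#|F| ^ 4 + #|F| ^ 3 + 2 * #|F| ^ 2 + #|F| + 1)%N.
  by rewrite sD; ring.
split=> //.
  by rewrite -(size_code_planes dimL); apply: card_eq_seq => [|U];
    [exact: code_planes_uniq | exact: mem_code_planes].
exists [set` D]; split.
- by rewrite -sizeD; exact: card_eq_seq.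
- by apply/seteqP; split=> // U [CU DU]; exact: (C_notin_D U).
- by move=> U /DS[].
- split=> [U [/(proj1 code)//|/DS[//]]|U U' [CU|DU] [CU'|DU'] N].
  + exact: (proj2 code).
  + by rewrite capvC; exact: DC.
  + exact: DC.
  + exact: DD.
have -> : (#|F| ^ 8 + #|F| ^ 4 + 2 * #|F| ^ 3 + 3 * #|F| ^ 2 + #|F| + 1)%N
    = size (code_planes L ++ D).
  by rewrite size_cat size_code_planes // sizeD; ring.
apply: card_eq_seq => [|U].
  rewrite cat_uniq code_planes_uniq // uD andbT; apply/hasPn => U DU.
  by apply/negP => /(mem_code_planes dimL) CU; exact: (C_notin_D U).
rewrite mem_cat; split=> [[/(mem_code_planes dimL)->//|DU]|/orP[]].
- by rewrite (DU : U \in D) orbT.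
- by move/(mem_code_planes dimL); left.
- by right.
Qed.
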